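(* Let $\varphi$ be a non-degenerate computable forecasting system and let $\omega\in\Omega$. Then $\omega$ is Schnorr random for $\varphi$ if and only if $\omega$ is Schnorr test random for $\varphi$.
   Context: Notation: $\mathbb N_0=\{0,1,2,\dots\}$; $\Omega=\{0,1\}^{\mathbb N}$ is the set of paths; $\mathbb S=\bigcup_{n\in\mathbb N_0}\{0,1\}^n$ the set of finite binary strings (situations), $\square$ the empty string, $|s|$ the length of $s$, $\omega^n$ the first $n$ entries of $\omega$ ($\omega^0=\square$), $sx$ concatenation. $[s]=\{\omega:\omega^{|s|}=s\}$, $[A]=\bigcup_{s\in A}[s]$. For $A\subseteq\mathbb N_0\times\mathbb S$: $A_n=\{s:(n,s)\in A\}$ and $A_n^{<\ell}=\{s\in A_n:|s|<\ell\}$. $\mathcal I$: nonempty closed subintervals of $[0,1]$; $\overline E_I(f)=\max_{p\in I}[pf(1)+(1-p)f(0)]$ for $f:\{0,1\}\to\mathbb R$. A forecasting system is $\varphi:\mathbb S\to\mathcal I$, with $\underline\varphi(s)=\min\varphi(s)$, $\overline\varphi(s)=\max\varphi(s)$; non-degenerate if $\underline\varphi(s)<1$ and $\overline\varphi(s)>0$ for all $s$. A supermartingale for $\varphi$ is $M:\mathbb S\to\mathbb R$ with $\overline E_{\varphi(s)}(M(s\,\cdot))\le M(s)$ for all $s$ ($M(s\,\cdot)$ is $x\mapsto M(sx)$); a test supermartingale is a non-negative one with $M(\square)=1$. For $G\subseteq\Omega$, $\overline P_\varphi(G)=\inf\{M(\square):M\text{ supermartingale for }\varphi,\ \liminf_nM(\omega^n)\ge\mathbb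 1_G(\omega)\ \forall\omega\}$. Computability: standard recursive maps/sets on encoded countable sets; a real map $r:\mathcal D\to\mathbb R$ is computable if there is a recursive $q:\mathcal D\times\mathbb N_0\to\mathbb Q$ with $|r(d)-q(d,N)|\le2^{-N}$; $\varphi$ is computable if $\underline\varphi,\overline\varphi$ are computable. A growth function is a recursive, non-decreasing, unbounded map $\rho:\mathbb N_0\to\mathbb N_0$. $\omega$ is Schnorr random for $\varphi$ if $\limsup_{n\to\infty}[T(\omega^n)-\rho(n)]\le0$ for every computable test supermartingale $T$ for $\varphi$ and every growth function $\rho$. A Schnorr test for $\varphi$ is a recursive set $A\subseteq\mathbb N_0\times\mathbb S$ with $\overline P_\varphi([A_n])\le2^{-n}$ for all $n$, for which there is a recursive map $e:\mathbb N_0^2\to\mathbb N_0$ (tail bound) with $\overline P_\varphi([A_n]\setminus[A_n^{<\ell}])\le2^{-N}$ for all $(N,n)\in\mathbb N_0^2$ and all $\ell\ge e(N,n)$. $\omega$ is Schnorr test random for $\varphi$ if $\omega\notin\bigcap_n[A_n]$ for every Schnorr test $A$ for $\varphi$. *)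

(* Defs.v *)
From mathcomp Require Import all_boot all_order all_algebra.
From mathcomp Require Import all_classical all_reals all_analysis.
From Stdlib Require List.
Set Implicit Arguments. Unset Strict Implicit. Unset Printing Implicit Defensive.
Import Order.TTheory GRing.Theory Num.Theory.
Local Open Scope classical_set_scope.
Local Open Scope ring_scope.

Inductive rprog : Type :=
| RZero : rprog
| RSucc : rprog
| RProj : nat -> rprog
| RComp : rprog -> list rprog -> rprog
| RPrec : rprog -> rprog -> rprog
| RMin  : rprog -> rprog.

Inductive ev : rprog -> seq nat -> nat -> Prop :=
| ev_zero v : ev RZero v 0
| ev_succ x v : ev RSucc (x :: v) x.+1
| ev_proj i v : (i < size v)%N -> ev (RProj i) v (nth 0%N v i)
| ev_comp f gs v ys y :
    List.Forall2 (fun g yi => ev g v yi) gs ys -> ev f ys y -> ev (RComp f gs) v y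
| ev_prec0 g h v y : ev g v y -> ev (RPrec g h) (0%N :: v) y
| ev_precS g h n v z y :
    ev (RPrec g h) (n :: v) z -> ev h (n :: z :: v) y ->
    ev (RPrec g h) (n.+1 :: v) y
| ev_min f v n :
    ev f (n :: v) 0 -> (forall m, (m < n)%N -> exists k, ev f (m :: v) k.+1) ->
    ev (RMin f) v n.

(* Cantor pairing (a bijection nat*nat -> nat). *)
Definition code_pair (a b : nat) : nat := ((a + b) * (a + b).+1)./2 + b.
(* Bijective binary numeration of finite binary strings:               *)
(* code [::] = 0, code (b :: s) = 2 * code s + 1 + b (a bijection).    *)
Fixpoint code_str (s : seq bool) : nat :=
  if s is b :: s' then (code_str s').*2 + 1 + b else 0.
Definition code_int (z : int) : nat :=
  match z with Posz n => n.*2 | Negz n => n.*2.+1 end.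
Definition code_rat (q : rat) : nat :=
  code_pair (code_int (numq q)) (`|denq q|%N).-1.

Definition recursive_N_N (f : nat -> nat) : Prop :=
  exists p, forall n, ev p [:: n] (f n).
Definition recursive_NN_N (f : nat -> nat -> nat) : Prop :=
  exists p, forall a b, ev p [:: code_pair a b] (f a b).
Definition recursive_set_NS (A : nat -> seq bool -> bool) : Prop :=
  exists p, forall n s, ev p [:: code_pair n (code_str s)] (nat_of_bool (A n s)).
Definition recursive_SN_Q (q : seq bool -> nat -> rat) : Prop :=
  exists p, forall s N, ev p [:: code_pair (code_str s) N] (code_rat (q s N)).

Section Forecasting.
Variable R : realType.

Definition computable_S_R (r : seq bool -> R) : Prop :=
  exists q : seq bool -> nat -> rat, recursive_SN_Q q /\
    forall s N, `| r s - ratr (q s N) | <= 2 ^- N.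

(* forecasting system: s |-> [lo s, hi s], a nonempty closed subinterval of [0,1] *)
Record fsys := FSys {
  flo : seq bool -> R;
  fhi : seq bool -> R;
  fsys_ok : forall s, 0 <= flo s /\ flo s <= fhi s /\ fhi s <= 1 }.

Definition upper_exp (lo hi : R) (f : bool -> R) : R :=
  sup [set p * f true + (1 - p) * f false | p in [set p : R | lo <= p <= hi]].

Definition non_degenerate (phi : fsys) : Prop :=
  forall s, flo phi s < 1 /\ 0 < fhi phi s.

Definition computable_fsys (phi : fsys) : Prop :=
  computable_S_R (flo phi) /\ computable_S_R (fhi phi).

Definition supermartingale (phi : fsys) (M : seq bool -> R) : Prop :=
  forall s, upper_exp (flo phi s) (fhi phi s) (fun x => M (rcons s x)) <= M s.

Definition test_supermartingale (phi : fsys) (M : seq bool -> R) : Prop :=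
  supermartingale phi M /\ (forall s, 0 <= M s) /\ M [::] = 1.

Definition prefix (w : nat -> bool) (n : nat) : seq bool := mkseq w n.
Definition cyl (s : seq bool) : set (nat -> bool) :=
  [set w | prefix w (size s) = s].
Definition cylU (B : seq bool -> bool) : set (nat -> bool) :=
  [set w | exists s, B s /\ cyl s w].

Definition upper_prob (phi : fsys) (G : set (nat -> bool)) : \bar R :=
  ereal_inf [set (M [::])%:E | M in
    [set M | supermartingale phi M /\
      forall w, ((\1_G w : R)%:E <= limn_einf (fun n => (M (prefix w n))%:E))%E]].

Definition growth_function (rho : nat -> nat) : Prop :=
  recursive_N_N rho /\ {homo rho : m n / (m <= n)%N} /\
  forall m, exists n, (m <= rho n)%N.

Definition schnorr_random (phi : fsys) (w : nat -> bool) : Prop :=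
  forall T rho, test_supermartingale phi T -> computable_S_R T ->
    growth_function rho ->
    (limn_esup (fun n => (T (prefix w n) - (rho n)%:R)%:E) <= 0)%E.

Definition An (A : nat -> seq bool -> bool) n : seq bool -> bool := A n.
Definition An_lt (A : nat -> seq bool -> bool) n (l : nat) : seq bool -> bool :=
  fun s => A n s && (size s < l)%N.

Definition schnorr_test (phi : fsys) (A : nat -> seq bool -> bool) : Prop :=
  recursive_set_NS A /\
  (forall n, (upper_prob phi (cylU (An A n)) <= (2 ^- n : R)%:E)%E) /\
  exists e, recursive_NN_N e /\
    forall N n l, (e N n <= l)%N ->
      (upper_prob phi (cylU (An A n) `\` cylU (An_lt A n l)) <= (2 ^- N : R)%:E)%E.

Definition schnorr_test_random (phi : fsys) (w : nat -> bool) : Prop :=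
  forall A, schnorr_test phi A -> ~ (forall n, cylU (An A n) w).

End Forecasting.

(* Main.v *)
Require Import Defs.
From mathcomp Require Import all_boot all_order all_algebra.
From mathcomp Require Import all_classical all_reals all_analysis.
From mathcomp Require Import zify ring lra.
Set Implicit Arguments. Unset Strict Implicit. Unset Printing Implicit Defensive.
Import Order.TTheory GRing.Theory Num.Theory.

(* A Schnorr test is obtained from a computable test supermartingale T that beats a
   growth function rho by collecting the situations s where T(s) almost reaches
   rho(|s|) and rho(|s|) is large: Ville's inequality bounds both the whole set and its
   tails.

   Conversely, let A be a Schnorr test. Choose a recursive sequence of lengths h(j) such
   that, for all n and j, the event that A_(2n+3) is first hit at a length at least h(j)
   has upper probability below 2^-(n+2j+2). Each time some level is newly hit at length
   m, pay a reward of lambda(m) = #{j : h(j) <= m}; the upper expectation T of the total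
   reward is a supermartingale with T(root) <= 1, and it exceeds the growth function
   lambda - 1 infinitely often along every path in all the A_n. The upper expectation
   with horizon L is computed by backward recursion on the binary tree. It approximates
   T(s) up to the value at s of a nonnegative supermartingale that is small at the root,
   and non-degeneracy bounds the factor by which such a supermartingale can grow between
   the root and s. *)

(** * Recursive functions of several variables: closure properties *)

Local Open Scope nat_scope.

(* Contexts are nested pairs [(x0, (x1, ... tt))] of naturals: a function under a binder
   is a function of the extended context, which lets the closure lemmas below apply to
   open terms. *)
Class Ctx (X : Type) := {
  arity : nat;
  enc : X -> seq nat;
  size_enc : forall x, size (enc x) = arity }.

#[local] Instance ctx_unit : Ctx unit :=
  {| arity := 0; enc := fun=> [::]; size_enc := fun=> erefl |}.

#[local] Instance ctx_cons X (C : Ctx X) : Ctx (nat * X) :=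
  {| arity := arity.+1; enc := fun x => x.1 :: enc x.2;
     size_enc := fun x => congr1 S (size_enc x.2) |}.

(** Programs receive their variables as a vector here; the translation to the single paired argument
    of the [recursive_] predicates is made once, by [rc2_of_coded] and [coded_of_rc2]. *)
Definition rc X (C : Ctx X) (f : X -> nat) :=
  exists p, forall x, ev p (enc x) (f x).
Arguments rc {X C} f.

Definition rcs X Y (C : Ctx X) (C' : Ctx Y) (g : X -> Y) :=
  exists ps, forall x, List.Forall2 (fun p y => ev p (enc x) y) ps (enc (g x)).
Arguments rcs {X Y C C'} g.

Section Closure.
Context {X : Type} {C : Ctx X}.

Lemma rc_ext (f g : X -> nat) : f =1 g -> rc f -> rc g.
Proof. by move=> fg [p hp]; exists p => x; rewrite -fg. Qed.

Lemma rc_comp Y (C' : Ctx Y) (f : Y -> nat) (g : X -> Y) :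
  rc f -> rcs g -> rc (fun x => f (g x)).
Proof.
move=> [p hp] [ps hps]; exists (RComp p ps) => x.
exact: ev_comp (hps x) (hp (g x)).
Qed.

Lemma rcs_nil : rcs (fun _ : X => tt).
Proof. by exists [::] => x; constructor. Qed.

Lemma rcs_cons Y (C' : Ctx Y) (a : X -> nat) (g : X -> Y) :
  rc a -> rcs g -> rcs (fun x => (a x, g x)).
Proof. by move=> [p hp] [ps hps]; exists (p :: ps) => x; constructor. Qed.

(** The offset [size v] makes the same fact yield the identity substitution and those that drop
    leading variables. *)
Lemma ev_projs (v w : seq nat) :
  List.Forall2 (fun p y => ev p (v ++ w) y)
    [seq RProj i | i <- iota (size v) (size w)] w.
Proof.
elim: w v => [|y w IH] v /=; first by constructor.
constructor.
  have := @ev_proj (size v) (v ++ y :: w).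
  by rewrite nth_cat ltnn subnn size_cat /=; apply; lia.
by have := IH (rcons v y); rewrite size_rcons cat_rcons.
Qed.

Lemma rcs_id : rcs (fun x : X => x).
Proof.
exists [seq RProj i | i <- iota 0 arity] => x.
by rewrite -(size_enc x); apply: (ev_projs [::]).
Qed.

Lemma rcs_snd : rcs (fun x : nat * X => x.2).
Proof.
exists [seq RProj i | i <- iota 1 arity] => x.
by rewrite -(size_enc x.2); apply: (ev_projs [:: x.1]).
Qed.

Lemma rc_fst : rc (fun x : nat * X => x.1).
Proof. by exists (RProj 0) => x; apply: (ev_proj (i := 0)). Qed.

Lemma rc_const n : rc (fun _ : X => n).
Proof.
elim: n => [|n [p hp]]; first by exists RZero => x; constructor.
exists (RComp RSucc [:: p]) => x.
by apply: (ev_comp (ys := [:: n])); repeat constructor.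
Qed.

End Closure.

Lemma rc_weaken X (C : Ctx X) (f : X -> nat) :
  rc f -> rc (fun x : nat * X => f x.2).
Proof. by move=> hf; apply: (rc_comp (C' := C)) => //; exact: rcs_snd. Qed.

Lemma rc_v1 X (C : Ctx X) : rc (fun x : nat * (nat * X) => x.2.1).
Proof. exact: rc_weaken (@rc_fst X C). Qed.
Lemma rc_v2 X (C : Ctx X) : rc (fun x : nat * (nat * (nat * X)) => x.2.2.1).
Proof. exact: rc_weaken (@rc_v1 X C). Qed.
Lemma rc_v3 X (C : Ctx X) : rc (fun x : nat * (nat * (nat * (nat * X))) => x.2.2.2.1).
Proof. exact: rc_weaken (@rc_v2 X C). Qed.
Lemma rc_v4 X (C : Ctx X) :
  rc (fun x : nat * (nat * (nat * (nat * (nat * X)))) => x.2.2.2.2.1).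
Proof. exact: rc_weaken (@rc_v3 X C). Qed.
Definition rc1 (f : nat -> nat) := rc (fun x : nat * unit => f x.1).
Definition rc2 (f : nat -> nat -> nat) :=
  rc (fun x : nat * (nat * unit) => f x.1 x.2.1).
Definition rc3 (f : nat -> nat -> nat -> nat) :=
  rc (fun x : nat * (nat * (nat * unit)) => f x.1 x.2.1 x.2.2.1).
Definition rc4 (f : nat -> nat -> nat -> nat -> nat) :=
  rc (fun x : nat * (nat * (nat * (nat * unit))) => f x.1 x.2.1 x.2.2.1 x.2.2.2.1).

Section App.
Context {X : Type} {C : Ctx X}.
Implicit Types a b c d : X -> nat.

Lemma rc_app1 f a : rc1 f -> rc a -> rc (fun x => f (a x)).
Proof.
move=> hf ha; apply: (rc_comp (g := fun x => (a x, tt)) hf).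
by apply: rcs_cons => //; exact: rcs_nil.
Qed.

Lemma rc_app2 f a b : rc2 f -> rc a -> rc b -> rc (fun x => f (a x) (b x)).
Proof.
move=> hf ha hb; apply: (rc_comp (g := fun x => (a x, (b x, tt))) hf).
by do 2 apply: rcs_cons => //; exact: rcs_nil.
Qed.

Lemma rc_app3 f a b c : rc3 f -> rc a -> rc b -> rc c ->
  rc (fun x => f (a x) (b x) (c x)).
Proof.
move=> hf ha hb hc; apply: (rc_comp (g := fun x => (a x, (b x, (c x, tt)))) hf).
by do 3 apply: rcs_cons => //; exact: rcs_nil.
Qed.

Lemma rc_app4 f a b c d : rc4 f -> rc a -> rc b -> rc c -> rc d ->
  rc (fun x => f (a x) (b x) (c x) (d x)).
Proof.
move=> hf ha hb hc hd.
apply: (rc_comp (g := fun x => (a x, (b x, (c x, (d x, tt))))) hf).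
by do 4 apply: rcs_cons => //; exact: rcs_nil.
Qed.

Lemma rc_succ a : rc a -> rc (fun x => (a x).+1).
Proof.
move=> ha; apply: (@rc_app1 S) => //.
by exists RSucc => x; constructor.
Qed.

Lemma rc_prec (g n : X -> nat) (h : nat -> nat -> X -> nat) :
  rc g -> rc (fun y : nat * (nat * X) => h y.1 y.2.1 y.2.2) -> rc n ->
  rc (fun x => nat_rect (fun=> nat) (g x) (fun m z => h m z x) (n x)).
Proof.
move=> [pg hg] [ph hh] hn.
suff hp : rc (C := ctx_cons C) (fun y : nat * X =>
    nat_rect (fun=> nat) (g y.2) (fun m z => h m z y.2) y.1).
  apply: (rc_comp (g := fun x => (n x, x)) hp).
  by apply: rcs_cons => //; exact: rcs_id.
exists (RPrec pg ph) => -[m x] /=; elim: m => [|m IH] /=.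
  by constructor.
by apply: ev_precS IH _; apply: (hh (m, (_, x))).
Qed.

(** [RMin] looks for the first zero, so the program decides the negation of [b]. Everything below
    that needs search uses this with an explicit description of the least witness. *)
Lemma rc_mu (b : nat -> X -> bool) (m : X -> nat) :
  rc (fun y : nat * X => ~~ b y.1 y.2) ->
  (forall x, b (m x) x) -> (forall x k, k < m x -> ~~ b k x) -> rc m.
Proof.
move=> [p hp] hm hk; exists (RMin p) => x; constructor.
  by have := hp (m x, x); rewrite /= hm.
by move=> k lt_k; exists 0; have := hp (k, x); rewrite /= (hk _ _ lt_k).
Qed.

End App.

Ltac rc_var := first [exact: rc_fst | exact: rc_v1 | exact: rc_v2 | exact: rc_v3
  | exact: rc_v4 | exact: rc_const].

Lemma rc2_add : rc2 addn.
Proof.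
apply: (rc_ext (f := fun x => nat_rect (fun=> nat) x.2.1 (fun _ z => z.+1) x.1)).
  by case=> a [b []] /=; elim: a => //= a ->.
by apply: (rc_prec (h := fun _ z _ => z.+1)); [| apply: rc_succ |]; rc_var.
Qed.

Lemma rc2_mul : rc2 muln.
Proof.
apply: (rc_ext (f := fun x => nat_rect (fun=> nat) 0 (fun _ z => x.2.1 + z) x.1)).
  by case=> a [b []] /=; elim: a => //= a ->; rewrite mulSn.
apply: (rc_prec (h := fun _ z x => x.2.1 + z)); try rc_var.
by apply: (rc_app2 rc2_add); rc_var.
Qed.

Lemma rc2_exp : rc2 expn.
Proof.
apply: (rc_ext (f := fun x => nat_rect (fun=> nat) 1 (fun _ z => x.1 * z) x.2.1)).
  by case=> a [b []] /=; elim: b => //= b ->; rewrite expnS.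
apply: (rc_prec (h := fun _ z x => x.1 * z)); try rc_var.
by apply: (rc_app2 rc2_mul); rc_var.
Qed.

Lemma rc1_pred : rc1 predn.
Proof.
apply: (rc_ext (f := fun x => nat_rect (fun=> nat) 0 (fun m _ => m) x.1)).
  by case=> -[].
by apply: (rc_prec (h := fun m _ _ => m)); rc_var.
Qed.

Lemma rc2_sub : rc2 subn.
Proof.
apply: (rc_ext (f := fun x => nat_rect (fun=> nat) x.1 (fun _ z => z.-1) x.2.1)).
  by case=> a [b []] /=; elim: b => [|b /= ->]; rewrite ?subn0 // subnS.
apply: (rc_prec (h := fun _ z _ => z.-1)); try rc_var.
by apply: (rc_app1 rc1_pred); rc_var.
Qed.

Section Bool.
Context {X : Type} {C : Ctx X}.
Implicit Types a b : X -> nat.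
Implicit Types p q : X -> bool.

Lemma rc_leq a b : rc a -> rc b -> rc (fun x => a x <= b x).
Proof.
move=> ha hb; apply: (rc_ext (f := fun x => 1 - (a x - b x))) => [x|]; first lia.
apply: (rc_app2 rc2_sub); first exact: rc_const.
exact: (rc_app2 rc2_sub).
Qed.

Lemma rc_and p q : rc p -> rc q -> rc (fun x => p x && q x).
Proof.
move=> hp hq; apply: (rc_ext (f := fun x => p x * q x)) => [x|].
  by rewrite mulnb.
exact: (rc_app2 rc2_mul).
Qed.

Lemma rc_neg p : rc p -> rc (fun x => ~~ p x).
Proof.
move=> hp; apply: (rc_ext (f := fun x => 1 - p x)) => [x|]; first by case: (p x).
by apply: (rc_app2 rc2_sub) => //; exact: rc_const.
Qed.

Lemma rc_or p q : rc p -> rc q -> rc (fun x => p x || q x).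
Proof.
move=> hp hq; apply: (rc_ext (f := fun x => ~~ (~~ p x && ~~ q x))) => [x|].
  by rewrite negb_and !negbK.
by apply: rc_neg; apply: rc_and; apply: rc_neg.
Qed.

(** Both branches are total, so the choice can be made arithmetically. *)
Lemma rc_if p a b : rc p -> rc a -> rc b -> rc (fun x => if p x then a x else b x).
Proof.
move=> hp ha hb.
apply: (rc_ext (f := fun x => p x * a x + (~~ p x) * b x)) => [x|].
  by case: (p x); rewrite /= ?mul1n ?mul0n ?addn0.
apply: (rc_app2 rc2_add); apply: (rc_app2 rc2_mul) => //.
exact: rc_neg.
Qed.

Lemma rc_sum (F : nat -> X -> nat) n :
  rc (fun y : nat * X => F y.1 y.2) -> rc n ->
  rc (fun x => \sum_(0 <= i < n x) F i x).
Proof.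
move=> hF hn.
apply: (rc_ext (f := fun x => nat_rect (fun=> nat) 0 (fun m z => F m x + z) (n x))).
  move=> x; elim: (n x) => [|m IH] /=; first by rewrite big_geq.
  by rewrite big_nat_recr //= IH addnC.
apply: (rc_prec (h := fun m z x => F m x + z)) => //; first exact: rc_const.
apply: (rc_app2 rc2_add); last by rc_var.
apply: (rc_comp (f := fun y : nat * X => F y.1 y.2) (g := fun y => (y.1, y.2.2))) => //.
apply: rcs_cons; first by rc_var.
exists [seq RProj i | i <- iota 2 arity] => -[m [z x]] /=.
by rewrite -(size_enc x); apply: (ev_projs [:: m; z]).
Qed.

Lemma rc_has (P : nat -> X -> bool) n :
  rc (fun y : nat * X => P y.1 y.2) -> rc n ->
  rc (fun x => has (P^~ x) (iota 0 (n x))).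
Proof.
move=> hP hn.
apply: (rc_ext (f := fun x => 1 <= \sum_(0 <= i < n x) P i x)) => [x|].
  rewrite has_count -sum1_count [in RHS]big_mkcond /index_iota subn0.
  by congr (nat_of_bool (0 < _)); apply: eq_bigr => i _; case: (P i x).
by apply: rc_leq; [exact: rc_const | exact: rc_sum].
Qed.

End Bool.

Lemma rc_eqn X (C : Ctx X) (a b : X -> nat) :
  rc a -> rc b -> rc (fun x => a x == b x).
Proof.
move=> ha hb; apply: (rc_ext (f := fun x => (a x <= b x) && (b x <= a x))).
  by move=> x; rewrite eqn_leq.
by apply: rc_and; apply: rc_leq.
Qed.

(** * Automatic decomposition of terms into recursive functions; [rc_string] is a hook filled in
    once string operations are known to be recursive *)

Ltac rc_string := fail.

Create HintDb rcdb.
Ltac rc_known :=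
  match goal with
  | |- rc (fun x => ?f (@?a x)) =>
      apply: (@rc_app1 _ _ f); [solve [eauto with rcdb] |]
  | |- rc (fun x => ?f (@?a x) (@?b x)) =>
      apply: (@rc_app2 _ _ f); [solve [eauto with rcdb] | |]
  | |- rc (fun x => ?f (@?a x) (@?b x) (@?c x)) =>
      apply: (@rc_app3 _ _ f); [solve [eauto with rcdb] | | |]
  | |- rc (fun x => ?f (@?a x) (@?b x) (@?c x) (@?d x)) =>
      apply: (@rc_app4 _ _ f); [solve [eauto with rcdb] | | | |]
  end.

Ltac rc_step :=
  lazymatch goal with
  | |- rc (fun x => nat_of_bool (@?p x && @?q x)) => apply: rc_and
  | |- rc (fun x => nat_of_bool (@?p x || @?q x)) => apply: rc_or
  | |- rc (fun x => nat_of_bool (~~ @?p x)) => apply: rc_neg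
  | |- rc (fun x => nat_of_bool (leq (@?p x) (@?q x))) => apply: rc_leq
  | |- rc (fun x => nat_of_bool (@?p x == @?q x)) => apply: rc_eqn
  | |- rc (fun x => addn (@?p x) (@?q x)) => apply: (rc_app2 rc2_add)
  | |- rc (fun x => muln (@?p x) (@?q x)) => apply: (rc_app2 rc2_mul)
  | |- rc (fun x => subn (@?p x) (@?q x)) => apply: (rc_app2 rc2_sub)
  | |- rc (fun x => expn (@?p x) (@?q x)) => apply: (rc_app2 rc2_exp)
  | |- rc (fun x => predn (@?p x)) => apply: (rc_app1 rc1_pred)
  | |- rc (fun x => if @?p x then _ else _) => apply: rc_if
  | |- rc (fun x => S (@?p x)) => first [exact: rc_const | apply: rc_succ]
  | |- rc (fun x => \sum_(0 <= i < @?n x) _) => apply: rc_sum; cbv beta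
  | |- rc (fun x => nat_of_bool (has _ (iota 0 _))) => apply: rc_has; cbv beta
  | |- _ => first [rc_var | assumption | rc_string | rc_known]
  end.
Ltac rct := repeat rc_step.

Lemma rc2_div : rc2 divn.
Proof.
(* The quotient is the least [m] with a < (m + 1) b; the first disjunct makes the search stop at 0
   when the divisor is 0, in accordance with [divn0]. *)
apply: (@rc_mu _ _ (fun m x => (x.2.1 == 0) || (x.1 < m.+1 * x.2.1))) => /=.
- by rct.
- case=> a [b []] /=; case: b => //= b; exact: ltn_ceil.
- case=> a [[|b] []] k //=; rewrite ?divn0 //= => lt_k.
  by rewrite -leqNgt -leq_divRL.
Qed.
#[local] Hint Resolve rc2_div : rcdb.

Lemma rc1_half : rc1 half.
Proof.
apply: (rc_ext (f := fun x => x.1 %/ 2)) => [x|]; first exact: divn2.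
by rct.
Qed.
#[local] Hint Resolve rc1_half : rcdb.

Lemma rc1_odd : rc1 odd.
Proof.
apply: (rc_ext (f := fun x => x.1 - x.1 %/ 2 * 2)) => [x|]; last first.
  by rct.
by rewrite -modn2 {1}(divn_eq x.1 2) addKn.
Qed.
#[local] Hint Resolve rc1_odd : rcdb.

(** * Inverse of the Cantor pairing *)

Lemma triangular_unbounded z : exists w, z < (w.+1 * w.+2)./2.
Proof. by exists z; rewrite -divn2 leq_divRL //; nia. Qed.

(** The diagonal a + b of the coded pair: the index of the last triangular number not exceeding
    [z]. *)
Definition unpair_diag (z : nat) : nat := ex_minn (triangular_unbounded z).

Definition unpair2 z := let w := unpair_diag z in z - (w * w.+1)./2.
Definition unpair1 z := unpair_diag z - unpair2 z.

Lemma unpair_diagE a b : unpair_diag (code_pair a b) = a + b.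
Proof.
have half_sum m : ((m.+1) * m.+2)./2 = (m * m.+1)./2 + m.+1.
  by rewrite [in LHS]mulnC -[m.+2]addn2 mulnDl mul2n halfD odd_double andbF doubleK.
have half_mono m n : m <= n -> (m * m.+1)./2 <= (n * n.+1)./2.
  by move=> mn; apply: half_leq; apply: leq_mul.
rewrite /unpair_diag; case: ex_minnP => w; rewrite /code_pair => hw minw.
apply/eqP; rewrite eqn_leq minw; last by rewrite half_sum; lia.
rewrite andTb leqNgt; apply/negP => lt_w.
have := half_mono _ _ lt_w; lia.
Qed.

Lemma unpair2K a b : unpair2 (code_pair a b) = b.
Proof. by rewrite /unpair2 unpair_diagE /code_pair addKn. Qed.

Lemma unpair1K a b : unpair1 (code_pair a b) = a.
Proof. by rewrite /unpair1 unpair2K unpair_diagE addnK. Qed.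

Lemma rc1_unpair_diag : rc1 unpair_diag.
Proof.
apply: (@rc_mu _ _ (fun w x => x.1 < ((w.+1) * w.+2)./2)); cbv beta.
- by rct.
- by move=> x; rewrite /unpair_diag; case: ex_minnP.
- move=> x k; rewrite /unpair_diag; case: ex_minnP => w _ minw.
  by apply: contraL => /minw; rewrite -leqNgt.
Qed.
#[local] Hint Resolve rc1_unpair_diag : rcdb.

Lemma rc1_unpair2 : rc1 unpair2.
Proof.
by rewrite /rc1 /unpair2; rct.
Qed.
#[local] Hint Resolve rc1_unpair2 : rcdb.

Lemma rc1_unpair1 : rc1 unpair1.
Proof.
by rewrite /rc1 /unpair1; rct.
Qed.
#[local] Hint Resolve rc1_unpair1 : rcdb.

Lemma rc2_pair : rc2 code_pair.
Proof. by rewrite /rc2 /code_pair; rct. Qed.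
#[local] Hint Resolve rc2_pair : rcdb.

Lemma rc_iter X (C : Ctx X) (f : nat -> nat) (n a : X -> nat) :
  rc1 f -> rc n -> rc a -> rc (fun x => iter (n x) f (a x)).
Proof.
move=> hf hn ha.
apply: (rc_ext (f := fun x => nat_rect (fun=> nat) (a x) (fun _ z => f z) (n x))).
  by move=> x; elim: (n x) => //= m ->.
apply: (rc_prec (h := fun _ z _ => f z)) => //.
by apply: (rc_app1 hf); rc_var.
Qed.

(** * Lists coded by iterated pairing, and recursion on the infinite binary tree *)

Definition nthc l j := unpair1 (iter j unpair2 l).

Lemma nthc0 x l : nthc (code_pair x l) 0 = x.
Proof. exact: unpair1K. Qed.

Lemma nthcS x l j : nthc (code_pair x l) j.+1 = nthc l j.
Proof. by rewrite /nthc iterSr unpair2K. Qed.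

Lemma rc2_nthc : rc2 nthc.
Proof.
rewrite /rc2 /nthc; rct.
by apply: rc_iter; [exact: rc1_unpair2 | rct | rct].
Qed.
#[local] Hint Resolve rc2_nthc : rcdb.

(* Nodes are numbered as in a heap: the children of [c] are [c.*2.+1] and
   [c.*2.+2]. The table lists the values at [c, c + 1, ..., 2n], so the children of
   [c - 1] sit at positions [c - 1] and [c]. *)
Lemma rc3_tree (leaf : nat -> nat -> nat) (node : nat -> nat -> nat -> nat -> nat)
    (bound : nat -> nat) (V : nat -> nat -> nat -> nat) :
  rc2 leaf -> rc4 node -> rc1 bound ->
  (forall L P c, bound L <= c -> V L P c = leaf c P) ->
  (forall L P c, c < bound L ->
    V L P c = node c (V L P c.*2.+1) (V L P c.*2.+2) P) ->
  rc3 V.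
Proof.
move=> hleaf hnode hbound V_leaf V_node.
pose entry c l n P := if n <= c then leaf c P else node c (nthc l c) (nthc l c.+1) P.
pose tab n P k := nat_rect (fun=> nat) 0
  (fun k l => code_pair (entry (n.*2 - k) l n P) l) k.
(* After [k] rounds the table starts at node 2n + 1 - k, so its entry [j] belongs to node 2n + 1 - k
   + j. *)
have tabE L P k : let n := bound L in k <= n.*2.+1 -> forall j, j < k ->
    nthc (tab n P k) j = V L P (n.*2.+1 - k + j).
  move=> n; elim: k => // k IH le_k [|j] lt_j; rewrite /tab /= ?nthc0 ?nthcS -/(tab n P k).
    have -> : n.*2.+1 - k.+1 + 0 = n.*2 - k by lia.
    rewrite /entry; case: leqP => [/V_leaf -> //|lt_n]; rewrite [RHS]V_node //.
    rewrite !IH; try lia.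
    by congr node; congr V; lia.
  by rewrite IH; try lia; congr V; lia.
have rc_tab : rc3 tab.
  rewrite /rc3 /tab.
  apply: (rc_prec (h := fun k l x => code_pair (entry (x.1.*2 - k) l x.1 x.2.1) l)).
  - by rct.
  - rewrite /entry; under [X in rc X]eq_fun do rewrite -!muln2.
    by rct.
  - by rct.
(* After 2n + 1 rounds the table starts at node 0, so position and node agree; nodes from the bound
   on are leaves and need no table. *)
apply: (rc_ext (f := fun x => if bound x.1 <= x.2.2.1 then leaf x.2.2.1 x.2.1
   else nthc (tab (bound x.1) x.2.1 (bound x.1 * 2).+1) x.2.2.1)).
  case=> L [P [c []]]; cbn [fst snd]; case: leqP => [/V_leaf -> //|lt_c].
  by rewrite muln2 tabE; [congr V; lia | lia | lia].
by rct.
Qed.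

(** * Binary strings *)

(* Codes the reversed string, so that appending a bit descends in the heap. *)
Definition cs (s : seq bool) : nat := code_str (rev s).

Lemma cs_rcons s b : cs (rcons s b) = (cs s).*2 + 1 + b.
Proof. by rewrite /cs rev_rcons. Qed.

Definition parent c := c.-1./2.

Lemma parent_cs s b : parent (cs (rcons s b)) = cs s.
Proof. by rewrite cs_rcons /parent; case: b; lia. Qed.

(** The inverse of [cs]. The code itself is enough fuel, since each step passes to a smaller
    code. *)
Fixpoint str_rec fuel c : seq bool :=
  if fuel is f.+1 then
    if c is c'.+1 then rcons (str_rec f c'./2) (odd c') else [::]
  else [::].
Definition str c := str_rec c c.

Lemma strK c : cs (str c) = c.
Proof.
rewrite /str; move: {2 3}c (leqnn c) => f; elim: f c => [|f IH] [|c] // lt_c.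
rewrite /= cs_rcons IH; last by lia.
have := odd_double_half c; lia.
Qed.

Lemma cs_inj : injective cs.
Proof.
move=> s t; elim/last_ind: s t => [|s b IH] t; case/lastP: t => [|t d] //;
  rewrite ?cs_rcons; try by rewrite /cs /=; lia.
move=> e; have eb : b = d by move: e; case: b; case: d => //; lia.
by rewrite eb (IH t) //; lia.
Qed.

Lemma csK s : str (cs s) = s.
Proof. by apply: cs_inj; rewrite strK. Qed.

Lemma cs_size s : 2 ^ size s <= (cs s).+1 < 2 ^ (size s).+1.
Proof.
elim/last_ind: s => // s b; rewrite size_rcons cs_rcons !expnS.
by case: b; lia.
Qed.

(** By [cs_size] the length is the least [m] with c + 1 < 2^(m+1). *)
Lemma rc1_size : rc1 (fun c => size (str c)).
Proof.
apply: (@rc_mu _ _ (fun m x => x.1.+1 < 2 ^ m.+1)); cbv beta.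
- by rct.
- by move=> x; have := cs_size (str x.1); rewrite strK => /andP[].
- move=> x k lt_k; have := cs_size (str x.1); rewrite strK => /andP[le_x _].
  by rewrite -leqNgt (leq_trans _ le_x) // leq_exp2l.
Qed.

Ltac rc_string ::=
  lazymatch goal with
  | |- rc (fun x => nat_of_bool (odd (@?c x))) => apply: (rc_app1 rc1_odd)
  | |- rc (fun x => size (str (@?c x))) => apply: (rc_app1 rc1_size)
  end.

Lemma rc1_parent : rc1 parent.
Proof. by rewrite /rc1 /parent; rct. Qed.

Lemma cs_take s i : i <= size s -> cs (take i s) = iter (size s - i) parent (cs s).
Proof.
elim/last_ind: s => [|s b IH] //; rewrite size_rcons leq_eqVlt => /orP[/eqP ->|lt_i].
  by rewrite subnn take_oversize ?size_rcons.
rewrite subSn // iterSr parent_cs -IH // -cats1 takel_cat //.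
Qed.

Lemma rc2_take : rc2 (fun i c => cs (take i (str c))).
Proof.
apply: (rc_ext (f := fun x => iter (size (str x.2.1) - x.1) parent x.2.1)).
  case=> i [c []] /=; case: (leqP i (size (str c))) => [le_i|lt_i].
    by rewrite cs_take // strK.
  by rewrite take_oversize ?strK 1?ltnW // (_ : _ - i = 0) //; lia.
by apply: rc_iter; [exact: rc1_parent | rct | rct].
Qed.

(** Reversal on codes is what passes between the numbering [cs] and the numbering [code_str]. *)
Lemma rc1_rev : rc1 (fun c => code_str (str c)).
Proof.
(* Removing the last [i] bits is [i] steps to the parent, and the last bit of what remains is the
   parity of its code minus 1. So [rv i] codes the final [i] bits, read from the end. *)
pose push i z c := z * 2 + 1 + odd (iter i parent c).-1.
pose rv i c := nat_rect (fun=> nat) 0 (fun i z => push i z c) i.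
have rvE s i : i <= size s -> rv i (cs s) = code_str (drop (size s - i) s).
  elim: i => [|i IH] le_i /=; first by rewrite subn0 drop_size.
  rewrite /push -/(rv i (cs s)) IH 1?ltnW //.
  have lt_d : size s - i.+1 < size s by lia.
  rewrite [in RHS](drop_nth false lt_d) /= -muln2; congr (_ * 2 + 1 + _).
    by congr code_str; congr drop; lia.
  have -> : iter i parent (cs s) = cs (take (size s - i.+1).+1 s).
    by rewrite cs_take; [congr iter; lia | lia].
  rewrite (take_nth false lt_d) cs_rcons addn1 addSn /= oddD odd_double.
  by case: nth.
apply: (rc_ext (f := fun x => rv (size (str x.1)) x.1)).
  by move=> x; rewrite -{2}(strK x.1) rvE // subnn drop0.
apply: (rc_prec (h := fun i z x => push i z x.1)); rewrite /push; rct.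
by apply: rc_iter; [exact: rc1_parent | rct | rct].
Qed.

Ltac rc_string ::=
  lazymatch goal with
  | |- rc (fun x => nat_of_bool (odd (@?c x))) => apply: (rc_app1 rc1_odd)
  | |- rc (fun x => size (str (@?c x))) => apply: (rc_app1 rc1_size)
  | |- rc (fun x => cs (take (@?i x) (str (@?c x)))) => apply: (rc_app2 rc2_take)
  | |- rc (fun x => code_str (str (@?c x))) => apply: (rc_app1 rc1_rev)
  end.

(** * Recursive maps on strings and computable reals *)

Lemma rc1P f : recursive_N_N f <-> rc1 f.
Proof.
split=> -[p hp]; exists p; first by case=> n []; exact: hp.
by move=> n; exact: (hp (n, tt)).
Qed.

Lemma rc2_of_coded (u v : nat -> nat) f : rc1 u -> rc1 v ->
  (exists p, forall a b, ev p [:: code_pair (u a) (v b)] (f a b)) -> rc2 f.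
Proof.
move=> hu hv [p hp].
have [pp hpp] : rc2 (fun a b => code_pair (u a) (v b)) by rewrite /rc2; rct.
exists (RComp p [:: pp]) => -[a [b []]].
apply: (ev_comp (ys := [:: code_pair (u a) (v b)])); last exact: hp.
by constructor => //; apply: (hpp (a, (b, tt))).
Qed.

Lemma coded_of_rc2 f : rc2 f -> exists p, forall a b, ev p [:: code_pair a b] (f a b).
Proof.
move=> hf; have [p hp] : rc1 (fun z => f (unpair1 z) (unpair2 z)) by rewrite /rc1; rct.
by exists p => a b; have := hp (code_pair a b, tt); rewrite /= unpair1K unpair2K.
Qed.

Lemma rc1_id : rc1 id. Proof. by rewrite /rc1; rct. Qed.

Lemma cs_code_str s : cs s = code_str (str (code_str s)).
Proof. by rewrite /cs -[in LHS](csK (rev s)) /cs revK. Qed.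

Lemma recursive_NN_N_rc2 f : recursive_NN_N f -> rc2 f.
Proof. exact: (rc2_of_coded rc1_id rc1_id). Qed.

Lemma rc2_recursive_NN_N f : rc2 f -> recursive_NN_N f.
Proof. exact: coded_of_rc2. Qed.

Lemma recursive_set_NS_rc2 A :
  recursive_set_NS A -> rc2 (fun n c => A n (str c)).
Proof.
move=> [p hp]; apply: (rc2_of_coded rc1_id rc1_rev).
by exists p => a b; apply: hp.
Qed.

Lemma rc2_recursive_set_NS (A : nat -> seq bool -> bool) :
  rc2 (fun n c => A n (str c)) -> recursive_set_NS A.
Proof.
move=> hA.
have [|p hp] := @coded_of_rc2 (fun n d => A n (str (code_str (str d)))).
  by apply: (rc_app2 hA); rct.
by exists p => n s; have := hp n (code_str s); rewrite -cs_code_str csK.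
Qed.

Lemma recursive_SN_Q_rc2 q :
  recursive_SN_Q q -> rc2 (fun N c => code_rat (q (str c) N)).
Proof.
move=> [p hp].
have hq : rc2 (fun c N => code_rat (q (str c) N)).
  by apply: (rc2_of_coded rc1_rev rc1_id); exists p => a b; apply: hp.
by apply: (rc_app2 hq); rct.
Qed.

Lemma rc2_recursive_SN_Q q :
  rc2 (fun N c => code_rat (q (str c) N)) -> recursive_SN_Q q.
Proof.
move=> hq.
have [|p hp] := @coded_of_rc2 (fun d N => code_rat (q (str (code_str (str d))) N)).
  by apply: (rc_app2 hq); rct.
by exists p => s N; have := hp (code_str s) N; rewrite -cs_code_str csK.
Qed.

Section Computable.
Local Open Scope ring_scope.
Variable R : realType.

(** Rounding the rational approximation down to a multiple of 2^-P costs a second error 2^-P, and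
    leaves only natural numerators to compute with. *)
Lemma computable_nat_approx (r : seq bool -> R) :
  computable_S_R r -> (forall s, 0 <= r s) ->
  exists2 x : nat -> nat -> nat, rc2 x &
    forall P s, `|r s - (x P (cs s))%:R / 2 ^+ P| <= 2 * 2 ^- P.
Proof.
move=> [q [/recursive_SN_Q_rc2 hq qr]] r_ge0.
pose code P c := code_rat (q (str c) P).
(* Integers with an odd code are negative and are replaced by 0, which is closer to the nonnegative
   real [r s]. *)
pose num z := (if odd (unpair1 z) then 0 else (unpair1 z)./2)%N.
pose x P c := (num (code P c) * 2 ^ P %/ (unpair2 (code P c)).+1)%N.
have rc_code : rc2 code := hq.
have rc_num : rc1 num by rewrite /rc1 /num; rct.
exists x => [|P s]; first by rewrite /rc2 /x; rct.
have p2 : 0 < 2 ^+ P :> R by rewrite exprn_gt0.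
rewrite /x /code csK /code_rat unpair2K /num unpair1K.
have := qr s P; set Q := q s P => hQ.
have eQ : ratr Q = (numq Q)%:~R / (`|denq Q|%N)%:R :> R.
  by rewrite /ratr [in RHS]pmulrn absz_denq.
have dgt0 : (0 < `|denq Q|)%N by rewrite absz_gt0 denq_neq0.
move: hQ; rewrite eQ prednK //; move: (`|denq Q|%N) dgt0 (numq Q) => d dgt0 [n|n] /=.
  rewrite odd_double doubleK -pmulrn => hQ.
  have d0 : 0 < d%:R :> R by rewrite ltr0n.
  set y := (n * 2 ^ P %/ d)%N.
  have y1 : y%:R * d%:R <= n%:R * 2 ^+ P :> R.
    by rewrite -natrX -!natrM ler_nat leq_trunc_div.
  have y2 : n%:R * 2 ^+ P <= (y%:R + 1) * d%:R :> R.
    by rewrite -natrX natr1 -!natrM ler_nat ltnW // ltn_ceil.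
  have z1 : y%:R / 2 ^+ P <= n%:R / d%:R :> R.
    by rewrite ler_pdivrMr // mulrAC ler_pdivlMr.
  have z2 : n%:R / d%:R <= y%:R / 2 ^+ P + 2 ^- P :> R.
    have -> : y%:R / 2 ^+ P + 2 ^- P = (y%:R + 1) / 2 ^+ P :> R by rewrite mulrDl mul1r.
    by rewrite ler_pdivlMr // mulrAC ler_pdivrMr.
  by rewrite ler_norml; move: hQ; rewrite ler_norml => /andP[? ?]; lra.
rewrite odd_double /= mul0n div0n mul0r subr0 NegzE.
rewrite rmorphN /= mulNr opprK ler_norml => /andP[_ hQ].
have hn : 0 <= n.+1%:~R / d%:R :> R by rewrite divr_ge0.
have e0 : 0 < 2 ^- P :> R by rewrite invr_gt0.
rewrite ger0_norm //; apply: le_trans (_ : 2 ^- P <= _); lra.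
Qed.

Lemma code_rat_odd_dyadic (V P : nat) :
  code_rat (V.*2.+1%:R / (2 ^ P.+1)%:R) = code_pair V.*2.+1.*2 (2 ^ P.+1).-1.
Proof.
have cop : coprime `|Posz V.*2.+1| `|Posz (2 ^ P.+1)%N|.
  by rewrite /= coprimeXr // coprimen2 /= odd_double.
have p0 : (2 ^ P.+1)%N != 0%N by rewrite expn_eq0.
rewrite /code_rat !pmulrn coprimeq_num // coprimeq_den //.
by rewrite eqz_nat (negbTE p0) gtr0_sg ?mul1r // ltz_nat lt0n.
Qed.

(* Numerators are kept odd so that the fractions are in lowest terms. *)
Lemma computable_of_nat (r : seq bool -> R) (V P : nat -> nat -> nat) :
  rc2 V -> rc2 P ->
  (forall N s, `|r s - (V N (cs s)).*2.+1%:R / (2 ^ (P N (cs s)).+1)%:R| <= 2 ^- N) ->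
  computable_S_R r.
Proof.
move=> hV hP hr.
exists (fun s N => (V N (cs s)).*2.+1%:R / (2 ^ (P N (cs s)).+1)%:R); split.
  apply: rc2_recursive_SN_Q.
  apply: (rc_ext (f := fun x => code_pair (V x.1 x.2.1 * 2).+1.*2
    (2 ^ (P x.1 x.2.1).+1).-1)).
    by case=> N [c []]; rewrite code_rat_odd_dyadic /= strK muln2.
  under [X in rc X]eq_fun do rewrite -muln2.
  by rct.
by move=> s N; rewrite fmorph_div !rmorph_nat.
Qed.

End Computable.

(** * Supermartingales *)

Section Limits.
Local Open Scope classical_set_scope.
Local Open Scope ereal_scope.
Variable R : realType.
Implicit Types (u : nat -> \bar R) (a : \bar R).

Lemma limn_esup_le u a N : (forall n, (N <= n)%N -> u n <= a) -> limn_esup u <= a.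
Proof.
move=> ua; apply: ge_ereal_inf; exists (ereal_sup (u @` [set n | (N <= n)%N])).
  by exists [set n | (N <= n)%N] => //; exists N.
by apply: ge_ereal_sup => _ [n /= Nn <-]; exact: ua.
Qed.

Lemma limn_esup_ge u a :
  (forall N, exists2 n, (N <= n)%N & a <= u n) -> a <= limn_esup u.
Proof.
move=> ua; apply: le_ereal_inf_tmp => _ [V [N _ NV] <-].
have [n Nn an] := ua N; apply: le_ereal_sup_tmp; exists (u n) => //.
by exists n => //; exact: NV.
Qed.

Lemma limn_einf_ge u a N : (forall n, (N <= n)%N -> a <= u n) -> a <= limn_einf u.
Proof.
by move=> ua; rewrite /limn_einf leeNr; apply: (limn_esup_le (N := N)) => n /ua ?;
  rewrite leeN2.
Qed.

Lemma limn_einf_le u a N : (forall n, (N <= n)%N -> u n <= a) -> limn_einf u <= a.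
Proof.
move=> ua; rewrite /limn_einf leeNl; apply: limn_esup_ge => M.
by exists (maxn N M); rewrite ?leq_maxr // leeN2 ua ?leq_maxl.
Qed.

End Limits.

Lemma size_path_prefix w n : size (Defs.prefix w n) = n.
Proof. exact: size_mkseq. Qed.

Lemma take_path_prefix w m n : m <= n -> take m (Defs.prefix w n) = Defs.prefix w m.
Proof.
by move=> mn; rewrite /Defs.prefix /mkseq -map_take take_iota; congr map;
  congr iota; lia.
Qed.

Lemma cyl_prefix w n : cyl (Defs.prefix w n) w.
Proof. by rewrite /cyl /= size_path_prefix. Qed.

Lemma cyl_take s w i : cyl s w -> i <= size s -> Defs.prefix w i = take i s.
Proof. by move=> <-; rewrite size_path_prefix => ?; rewrite take_path_prefix. Qed.

Section Supermartingale.
Local Open Scope ring_scope.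
Variables (R : realType) (phi : fsys R).
Implicit Types (M : seq bool -> R) (s : seq bool).

Definition mean (p : R) M s := p * M (rcons s true) + (1 - p) * M (rcons s false).

(** The expectation is affine in [p], so its maximum over the interval is taken at an endpoint. *)
Lemma supermartingaleP M : supermartingale phi M <->
  forall s, mean (flo phi s) M s <= M s /\ mean (fhi phi s) M s <= M s.
Proof.
split=> hM s; have [lo0 [lohi hi1]] := fsys_ok phi s.
  set f := fun x => M (rcons s x).
  set A := [set p * f true + (1 - p) * f false
    | p in [set p | flo phi s <= p <= fhi phi s]]%classic.
  (* The real [sup] bounds its set only once the set is known to be nonempty and bounded. *)
  have ubA : has_sup A.
    split; first by exists (mean (flo phi s) M s); exists (flo phi s) => //=; rewrite lexx.
    exists (`|f true| + `|f false|) => _ [p /= /andP[lo_p p_hi] <-].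
    have := ler_norm (f true); have := ler_norm (f false).
    by have := normr_ge0 (f true); have := normr_ge0 (f false); nra.
  have le_sup x : A x -> x <= sup A by move=> Ax; exact: ub_le_sup ubA.2 _ Ax.
  split; apply: le_trans (hM s); apply: le_sup.
    by exists (flo phi s) => //=; rewrite lexx.
  by exists (fhi phi s) => //=; rewrite lexx andbT.
have [h1 h2] := hM s; apply: ge_sup.
  by exists (mean (flo phi s) M s); exists (flo phi s) => //=; rewrite lexx.
move=> _ [p /= /andP[lo_p p_hi] <-]; move: h1 h2; rewrite /mean.
move: (M (rcons s true)) (M (rcons s false)) => x y h1 h2.
by have [xy|/ltW yx] := lerP x y; nra.
Qed.

Lemma supermartingale_descends M s :
  supermartingale phi M -> exists b, M (rcons s b) <= M s.
Proof.
move=> /supermartingaleP /(_ s) [hlo _]; have [lo0 [lohi hi1]] := fsys_ok phi s.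
apply: contrapT => /forallNP hb.
have := hb true; have := hb false => /negP; rewrite -ltNge => h0.
move=> /negP; rewrite -ltNge => h1; move: hlo; rewrite /mean.
move: (M (rcons s true)) (M (rcons s false)) h0 h1 => x y h0 h1 hlo.
by have [xy|/ltW yx] := lerP x y; nra.
Qed.

(* Always move to a child on which [M] does not increase. *)
Lemma supermartingale_path M s : supermartingale phi M ->
  exists2 w, cyl s w & forall n, (size s <= n)%N -> M (Defs.prefix w n) <= M s.
Proof.
move=> hM.
pose next t := rcons t (M (rcons t true) <= M t).
have next_le t : M (next t) <= M t.
  rewrite /next; case: (boolP (M (rcons t true) <= M t)) => // h1.
  have [[] //] := supermartingale_descends t hM.
  by rewrite (negbTE h1).
pose ext k := iter k next s.
have size_ext k : size (ext k) = (size s + k)%N.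
  by elim: k => [|k IH]; rewrite ?addn0 //= size_rcons IH addnS.
have ext_le k : M (ext k) <= M s.
  by elim: k => [|k IH] //=; apply: le_trans IH.
have nth_ext k j i : (i < size s + k)%N ->
    nth false (ext (k + j)%N) i = nth false (ext k) i.
  move=> lt_i; elim: j => [|j IH]; first by rewrite addn0.
  rewrite addnS [ext _]/= -/(ext _) nth_rcons size_ext.
  by rewrite (leq_trans lt_i) //; lia.
(* The limit path: [ext n.+1] has length greater than [n], and later extensions keep its bits. *)
pose w n := nth false (ext n.+1) n.
have wE k : Defs.prefix w (size s + k) = ext k.
  apply: (@eq_from_nth _ false) => [|i]; rewrite size_path_prefix ?size_ext // => lt_i.
  rewrite nth_mkseq // /w.
  have [le_ik|lt_ki] := leqP i.+1 k.
    by have := @nth_ext i.+1 (k - i.+1)%N i; rewrite subnKC // => ->; lia.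
  by have := @nth_ext k (i.+1 - k)%N i lt_i; rewrite subnKC // ltnW.
exists w; first by have := wE 0%N; rewrite addn0.
by move=> n le_n; have := wE (n - size s)%N; rewrite subnKC // => ->.
Qed.

(** A strict bound is met by some member of the infimum. Along a path through [s] on which this
    member stays at most M(s), the limit inferior bounds M(s) from below by the indicator: by 0
    always, by 1 if all of [s] lies in [G]. *)
Lemma upper_prob_witness (G : set (nat -> bool)) (a : R) :
  (upper_prob phi G < a%:E)%E ->
  exists M, [/\ supermartingale phi M, M [::] < a, (forall s, 0 <= M s) &
    forall s, cyl s `<=` G -> 1 <= M s]%classic.
Proof.
move=> /ereal_inf_lt[_ [M /= [hM limM] <-]]; rewrite lte_fin => Ma.
have below s (c : R) : (forall w, cyl s w -> (c%:E <= (\1_G w : R)%:E)%E) -> c <= M s.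
  move=> hc; have [w sw wM] := supermartingale_path s hM.
  rewrite -lee_fin; apply: le_trans (hc w sw) _; apply: le_trans (limM w) _.
  by apply: (limn_einf_le (N := size s)) => n ?; rewrite lee_fin wM.
exists M; split=> // s; first by apply: below => w _; rewrite lee_fin indicE.
by move=> sG; apply: below => w /sG Gw; rewrite indicE mem_set.
Qed.

Lemma upper_prob_le (G : set (nat -> bool)) M (a : R) :
  supermartingale phi M -> (forall s, 0 <= M s) -> M [::] <= a ->
  (forall w, G w -> exists N, forall n, (N <= n)%N -> 1 <= M (Defs.prefix w n)) ->
  (upper_prob phi G <= a%:E)%E.
Proof.
move=> hM M0 Ma GM; apply: ge_ereal_inf; exists (M [::])%:E; last by rewrite lee_fin.
exists M => //; split=> // w; rewrite indicE.
have [/set_mem Gw|_] := boolP (w \in G); last first.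
  by apply: (limn_einf_ge (N := 0%N)) => n _; rewrite lee_fin.
by have [N hN] := GM w Gw; apply: (limn_einf_ge (N := N)) => n /hN; rewrite lee_fin.
Qed.

(* Freezing [M / K] once it has reached 1. *)
Lemma ville M (G : set (nat -> bool)) (B : seq bool -> bool) (K : R) :
  supermartingale phi M -> (forall s, 0 <= M s) -> 0 < K ->
  (G `<=` cylU B)%classic -> (forall s, B s -> K <= M s) ->
  (upper_prob phi G <= (M [::] / K)%:E)%E.
Proof.
move=> hM M0 K0 GB BM.
pose hit s := has (fun i => B (take i s)) (iota 0 (size s).+1).
pose N s := if hit s then 1 else M s / K.
have hitP s : reflect (exists2 i, (i <= size s)%N & B (take i s)) (hit s).
  apply: (iffP hasP) => [[i]|[i le_i Bi]]; first by rewrite mem_iota => ? ?; exists i.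
  by exists i => //; rewrite mem_iota.
have hit_rcons s b : hit s -> hit (rcons s b).
  move=> /hitP[i le_i Bi]; apply/hitP; exists i; first by rewrite size_rcons ltnW.
  by rewrite -cats1 takel_cat.
(* At a first hit [M / K] is at least 1, so replacing it by 1 only lowers the value. *)
have N_le s b : ~~ hit s -> N (rcons s b) <= M (rcons s b) / K.
  rewrite /N => nh; case: ifPn => // /hitP[i]; rewrite size_rcons leq_eqVlt.
  rewrite ler_pdivlMr // mul1r.
  move=> /orP[/eqP ->|lt_i]; first by rewrite take_oversize ?size_rcons // => /BM.
  rewrite -cats1 takel_cat // => Bi; case/negP: nh; apply/hitP.
  by exists i.
apply: (@upper_prob_le _ N).
- apply/supermartingaleP => s; have [lo0 [lohi hi1]] := fsys_ok phi s.
  have hs p : 0 <= p <= 1 -> mean p M s <= M s -> mean p N s <= N s.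
    move=> /andP[p0 p1]; rewrite /mean; have [h|nh] := boolP (hit s).
      by rewrite /N h !hit_rcons //; lra.
    move=> hp; have := N_le s true nh; have := N_le s false nh.
    rewrite [N s]/N (negbTE nh) => h0 h1.
    rewrite ler_pdivlMr //.
    move: h0 h1; rewrite !ler_pdivlMr // => h0 h1; nra.
  have [h1 h2] := (supermartingaleP M).1 hM s.
  by split; apply: hs => //; apply/andP; split; lra.
- by move=> s; rewrite /N; case: ifP => // _; rewrite divr_ge0 // ltW.
- rewrite /N; case: ifPn => // /hitP[[|i] //= _ /BM].
  by rewrite ler_pdivlMr // mul1r.
- move=> w /GB[s [Bs sw]]; exists (size s) => n le_n; rewrite /N.
  suff -> : hit (Defs.prefix w n) by [].
  by apply/hitP; exists (size s); rewrite ?size_path_prefix // take_path_prefix // sw.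
Qed.

End Supermartingale.

(** * Schnorr test randomness implies Schnorr randomness *)

Section TestRandom.
Local Open Scope ring_scope.

Lemma schnorr_test_random_random (R : realType) (phi : fsys R) w :
  schnorr_test_random phi w -> schnorr_random phi w.
Proof.
move=> hw T rho [hT [T0 T1]] cT [/rc1P hrho [rho_mono rho_unb]].
apply: contrapT => /negP; rewrite -ltNge => lim_gt0.
have inf N : exists2 n, (N <= n)%N & (rho n)%:R < T (Defs.prefix w n).
  apply: contrapT => hN; move: lim_gt0; apply/negP; rewrite -leNgt.
  apply: (limn_esup_le (N := N)) => n Nn; rewrite lee_fin subr_le0 leNgt.
  by apply/negP => lt_T; apply: hN; exists n.
have [x hx xT] := computable_nat_approx cT T0.
have {}xT s : `|T s - (x 0%N (cs s))%:R| <= 2.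
  by have := xT 0%N s; rewrite expr0 invr1 !mulr1.
(* [x 0] is within 2 of [T]. The slack 2 in the first condition admits every [s] with T(s) >
   rho(|s|); conversely membership gives T(s) >= rho(|s|) - 4, hence the constant 4 in the second
   condition. *)
pose A n s := (rho (size s) <= x 0%N (cs s) + 2)%N && (2 ^ n + 4 <= rho (size s))%N.
have A_ge n s N : A n s -> (2 ^ N + 4 <= rho (size s))%N -> 2 ^+ N <= T s.
  rewrite /A => /andP[h1 _] h2; have := xT s; rewrite ler_norml => /andP[+ _].
  have : (2 ^ N + 4)%:R <= (x 0%N (cs s) + 2)%:R :> R by rewrite ler_nat (leq_trans h2).
  by rewrite !natrD natrX; lra.
have ex_e N : exists m, (2 ^ N + 4 <= rho m)%N by exact: rho_unb.
apply: (hw A); last first.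
  move=> n; have [m0 hm0] := ex_e n; have [m le_m lt_T] := inf m0.
  exists (Defs.prefix w m); split; last exact: cyl_prefix.
  rewrite /An /A size_path_prefix (leq_trans hm0) ?rho_mono // andbT.
  rewrite -(ler_nat R) natrD; have := xT (Defs.prefix w m).
  by rewrite ler_norml => /andP[_ +]; lra.
have pow_gt0 n : 0 < 2 ^+ n :> R by rewrite exprn_gt0.
have root_div n : 2 ^- n = T [::] / 2 ^+ n by rewrite T1 mul1r.
split; [|split].
- apply: rc2_recursive_set_NS.
  apply: (rc_ext (f := fun y => (rho (size (str y.2.1)) <= x 0%N y.2.1 + 2)%N &&
    (2 ^ y.1 + 4 <= rho (size (str y.2.1)))%N)).
    by move=> y; rewrite /A strK.
  by rct.
- move=> n; rewrite root_div; apply: (ville (B := A n) hT T0) => // s As.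
  by apply: (A_ge n) => //; move: As => /andP[].
(* The tail bound is the length at which [rho] reaches 2^N + 4, the same for all [n]. *)
- exists (fun N _ => ex_minn (ex_e N)); split.
    apply: rc2_recursive_NN_N.
    apply: (@rc_mu _ _ (fun m y => 2 ^ y.1 + 4 <= rho m)%N); cbv beta.
    + by rct.
    + by move=> y; case: ex_minnP.
    + move=> y k; case: ex_minnP => m _ minm.
      by apply: contraL => /minm; rewrite -leqNgt.
  move=> N n l; case: ex_minnP => m hm _ le_l.
  rewrite root_div.
  (* Paths that avoid all short members of A_n can enter only through members of length at least
     [l], where T >= 2^N. *)
  apply: (ville (B := fun s => A n s && (l <= size s)%N) hT T0) => //.
    move=> v [[s [As sv]] nlt]; exists s; split=> //; apply/andP; split=> //.
    rewrite leqNgt; apply/negP => lt_s; apply: nlt; exists s; split=> //.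
    exact/andP.
  move=> s /andP[As le_s]; apply: (A_ge n) => //.
  by rewrite (leq_trans hm) // rho_mono // (leq_trans le_l).
Qed.

End TestRandom.

(** * From a Schnorr test to a supermartingale *)

Section Reward.
Variables (A : nat -> seq bool -> bool) (e : nat -> nat -> nat).

(** This is h(j). Summing over all i <= j makes it monotone, the first term puts it above 2j, and
    the last block dominates e(4j+3, 2n+3) for n <= 2j; there 4j + 3 > n + 2j + 2. *)
Definition tail_len j :=
  (2 * j).+1 +
  \sum_(0 <= i < j.+1) \sum_(0 <= n < (2 * i).+1) e (4 * i + 3) (2 * n + 3).

Lemma tail_len_mono i j : i <= j -> tail_len i <= tail_len j.
Proof.
move=> ij; rewrite /tail_len [in leqRHS](@big_cat_nat _ _ _ i.+1) //=.
by rewrite addnA (leq_trans _ (leq_addr _ _)) // leq_add2r; lia.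
Qed.

Lemma tail_len_ge n j : n <= 2 * j -> e (4 * j + 3) (2 * n + 3) <= tail_len j.
Proof.
move=> nj; rewrite /tail_len big_nat_recr //= (@big_cat_nat _ _ _ n _ (2 * j).+1) //=.
  by rewrite (big_nat_recl _ n) //=; lia.
exact: leqW.
Qed.

Lemma tail_len_gt j : 2 * j < tail_len j.
Proof. by rewrite /tail_len leq_addr. Qed.

(* The length condition keeps the hits of infinitely many levels at infinitely many
   times, and leaves only levels [n <= size s] to inspect at [s]. *)
Definition hit n s :=
  (n <= size s) && has (fun i => A (2 * n + 3) (take i s)) (iota 0 (size s).+1).

(** The empty string is its own truncation, so nothing is newly hit at the root. *)
Definition newhit n s := hit n s && ~~ hit n (take (size s).-1 s).

(** This is lambda(m): the range j < m loses nothing, as h(j) > 2j. *)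
Definition growth m := \sum_(0 <= j < m) (tail_len j <= m).

Definition reward s := growth (size s) * \sum_(0 <= n < (size s).+1) newhit n s.

Definition total_reward s := \sum_(0 <= k < (size s).+1) reward (take k s).

Definition tail_reward i s :=
  \sum_(0 <= k < (size s).+1) (tail_len i <= k) * reward (take k s).

Definition hits n j s :=
  \sum_(0 <= k < (size s).+1) (newhit n (take k s) && (tail_len j <= k)).

Lemma hitP n s : reflect
  (n <= size s /\ exists2 i, i <= size s & A (2 * n + 3) (take i s)) (hit n s).
Proof.
apply: (iffP andP) => -[le_n hA]; split=> //.
  by move: hA => /hasP[i]; rewrite mem_iota => ? ?; exists i.
by move: hA => [i le_i Ai]; apply/hasP; exists i => //; rewrite mem_iota.
Qed.

Lemma take_rcons_le (s : seq bool) b k : k <= size s -> take k (rcons s b) = take k s.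
Proof. by move=> le_k; rewrite -cats1 takel_cat. Qed.

Lemma hit_rcons n s b : hit n s -> hit n (rcons s b).
Proof.
move=> /hitP[le_n [i le_i Ai]]; apply/hitP; rewrite size_rcons; split; first lia.
by exists i; rewrite ?take_rcons_le //; lia.
Qed.

Lemma newhit_rcons n s b : newhit n (rcons s b) = hit n (rcons s b) && ~~ hit n s.
Proof. by rewrite /newhit size_rcons /= take_rcons_le // take_size. Qed.

Lemma sum_take_rcons (F : nat -> seq bool -> nat) s b :
  \sum_(0 <= k < (size (rcons s b)).+1) F k (take k (rcons s b)) =
  \sum_(0 <= k < (size s).+1) F k (take k s) + F (size s).+1 (rcons s b).
Proof.
rewrite size_rcons big_nat_recr //= take_oversize ?size_rcons //; congr (_ + _).
rewrite !big_nat; apply: eq_bigr => k; rewrite ltnS => le_k.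
by rewrite take_rcons_le.
Qed.

Lemma total_reward_rcons s b :
  total_reward (rcons s b) = total_reward s + reward (rcons s b).
Proof. exact: (sum_take_rcons (fun _ => reward)). Qed.

(** A hit persists under extension, so each level is newly hit at most once along a string. *)
Lemma hits_le_hit n j s : hits n j s <= hit n s.
Proof.
elim/last_ind: s => [|s b IH].
  by rewrite /hits big_nat1 /newhit /= andbN.
rewrite /hits (sum_take_rcons (fun k t => newhit n t && (tail_len j <= k))).
rewrite newhit_rcons -/(hits n j s).
have [h|nh] := boolP (hit n s).
  by rewrite hit_rcons // andbF addn0 (leq_trans IH) // h.
move: IH; rewrite (negbTE nh) leqn0 => /eqP ->; rewrite add0n andbT.
by case: (hit n (rcons s b)); case: (tail_len j <= _).
Qed.

Lemma hits_gt0 n j s : 0 < hits n j s ->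
  exists k, [/\ k <= size s, newhit n (take k s) & tail_len j <= k].
Proof.
rewrite /hits => h; apply: contrapT => hk; move: h; rewrite big_nat big1 // => k.
rewrite ltnS => le_k; case: andP => // -[h1 h2]; case: hk; exists k; split=> //.
Qed.

(** A unit of reward paid at length k >= h(i) belongs to a level [n] newly hit there and an index
    [j] with h(j) <= k; then h(max(i,j)) <= k as well, so [hits] counts it. *)
Lemma tail_reward_le i s L : size s <= L ->
  tail_reward i s <= \sum_(0 <= n < L.+1) \sum_(0 <= j < L) hits n (maxn i j) s.
Proof.
move=> le_L.
have -> : \sum_(0 <= n < L.+1) \sum_(0 <= j < L) hits n (maxn i j) s =
    \sum_(0 <= k < (size s).+1) \sum_(0 <= n < L.+1) \sum_(0 <= j < L)
      (newhit n (take k s) && (tail_len (maxn i j) <= k)).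
  rewrite [RHS]exchange_big_nat; apply: eq_bigr => n _; exact: exchange_big_nat.
rewrite /tail_reward big_nat [leqRHS]big_nat.
apply: leq_sum => k; rewrite ltnS => /andP[_ le_k].
rewrite /reward size_takel //; have [le_i|_] := leqP (tail_len i) k; last by rewrite mul0n.
rewrite mul1n [leqRHS](@big_cat_nat _ _ _ k.+1) //=; last by lia.
rewrite (leq_trans _ (leq_addr _ _)) // big_distrr /=; apply: leq_sum => n _.
rewrite [leqRHS](@big_cat_nat _ _ _ k) //=; last by lia.
rewrite (leq_trans _ (leq_addr _ _)) // /growth big_distrl /=.
apply: leq_sum => j _; have [le_j|//] := leqP (tail_len j) k.
rewrite mul1n; case: newhit => //=.
by case: (leqP i j) => _; rewrite ?le_i ?le_j.
Qed.

Lemma total_reward_split i s k : tail_len i <= k -> k <= size s ->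
  total_reward s <= total_reward (take k s) + tail_reward i s.
Proof.
move=> le_i le_k; rewrite /total_reward size_takel // (@big_cat_nat _ _ _ k.+1) //=.
apply: leq_add.
  rewrite !big_nat; apply: leq_sum => j; rewrite ltnS => /andP[_ le_j].
  by rewrite take_takel.
rewrite /tail_reward [leqRHS](@big_cat_nat _ _ _ k.+1) //=.
rewrite (leq_trans _ (leq_addl _ _)) // !big_nat; apply: leq_sum => j /andP[lt_j _].
by rewrite (leq_trans le_i) ?mul1n // ltnW.
Qed.

(** A crude bound on the size of the values, needed later to control the rounding errors. *)
Lemma total_reward_le s : total_reward s <= (size s).+1 ^ 3.
Proof.
have growth_le m : growth m <= m.
  rewrite /growth (leq_trans (leq_sum _ (fun j _ => leq_b1 _))) //.
  by rewrite sum_nat_const_nat muln1 subn0.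
have reward_le t : reward t <= (size t).+1 * (size t).+1.
  rewrite /reward leq_mul // ?(leq_trans (growth_le _)) //.
  rewrite (leq_trans (leq_sum _ (fun j _ => leq_b1 _))) //.
  by rewrite sum_nat_const_nat muln1 subn0.
rewrite /total_reward !expnS expn0 muln1 -[X in X * _]subn0 -sum_nat_const_nat !big_nat.
apply: leq_sum => k; rewrite ltnS => /andP[_ le_k].
by rewrite (leq_trans (reward_le _)) // size_takel // leq_mul.
Qed.

(** Lengths below h(0) pay nothing, because [growth] vanishes there. *)
Lemma total_reward_le_tail s : total_reward s <= tail_reward 0 s.
Proof.
apply: leq_sum => k _; have [le_k|lt_k] := leqP (tail_len 0) k; first by rewrite mul1n.
rewrite /reward; set m := size (take k s).
have lt_m : m < tail_len 0 by rewrite /m (leq_ltn_trans _ lt_k) // size_take_min geq_minl.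
rewrite /growth big1 // => j _; apply/eqP; rewrite eqb0 -ltnNge.
exact: leq_trans lt_m (tail_len_mono (leq0n j)).
Qed.

Lemma growth_mono : {homo growth : m n / m <= n}.
Proof.
move=> m n mn; rewrite /growth [leqRHS](@big_cat_nat _ _ _ m) //=.
rewrite (leq_trans _ (leq_addr _ _)) //; apply: leq_sum => j _.
by case: leqP => // le_m; rewrite (leq_trans le_m).
Qed.

Lemma growth_ge k m : tail_len k <= m -> k <= growth m.
Proof.
move=> le_m; have le_k : k <= m by have := tail_len_gt k; lia.
rewrite /growth (@big_cat_nat _ _ _ k) //= (leq_trans _ (leq_addr _ _)) //.
rewrite -{1}[k]subn0 -[_ - _]muln1 -sum_nat_const_nat !big_nat.
apply: leq_sum => j /andP[_ lt_j].
by rewrite (leq_trans (tail_len_mono (ltnW lt_j))).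
Qed.

End Reward.

(** * Growth of supermartingales, and upper expectations with finite horizon *)

Section Process.
Local Open Scope ring_scope.
Variables (R : realType) (phi : fsys R).
Implicit Types (M N : seq bool -> R) (s t : seq bool).

Lemma mean_le (p : R) M N s : 0 <= p <= 1 ->
  (forall b, M (rcons s b) <= N (rcons s b)) -> mean p M s <= mean p N s.
Proof.
move=> /andP[p0 p1] MN; rewrite /mean.
have := MN true; have := MN false; nra.
Qed.

Lemma flo01 s : 0 <= flo phi s <= 1.
Proof. by have [? [? ?]] := fsys_ok phi s; apply/andP; split; lra. Qed.

Lemma fhi01 s : 0 <= fhi phi s <= 1.
Proof. by have [? [? ?]] := fsys_ok phi s; apply/andP; split; lra. Qed.

Lemma supermartingaleD M N : supermartingale phi M -> supermartingale phi N ->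
  supermartingale phi (fun s => M s + N s).
Proof.
move=> /supermartingaleP hM /supermartingaleP hN; apply/supermartingaleP => s.
have [m1 m2] := hM s; have [n1 n2] := hN s.
by move: m1 m2 n1 n2; rewrite /mean => *; split; lra.
Qed.

Lemma supermartingale_cst (c : R) : supermartingale phi (fun=> c).
Proof. by apply/supermartingaleP => s; rewrite /mean; split; lra. Qed.

Lemma supermartingale_sum I (r : seq I) (F : I -> seq bool -> R) :
  (forall i, supermartingale phi (F i)) ->
  supermartingale phi (fun s => \sum_(i <- r) F i s).
Proof.
move=> hF; elim: r => [|i r IH].
  under [X in supermartingale _ X]eq_fun do rewrite big_nil.
  exact: supermartingale_cst.
under [X in supermartingale _ X]eq_fun do rewrite big_cons.
exact: supermartingaleD.
Qed.

(** By nonnegativity, the upper endpoint bounds the child with bit 1 and the lower endpoint the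
    child with bit 0, each by 2^K(s) M(s). *)
Lemma supermartingale_growth (K : seq bool -> nat) M :
  (forall s, 2 ^- K s <= fhi phi s /\ 2 ^- K s <= 1 - flo phi s) ->
  supermartingale phi M -> (forall s, 0 <= M s) ->
  forall s, M s <= 2 ^+ (\sum_(0 <= k < size s) K (take k s))%N * M [::].
Proof.
move=> hK /supermartingaleP hM M0; elim/last_ind => [|s b IH].
  by rewrite big_geq // mul1r.
rewrite size_rcons big_nat_recr //= take_rcons_le // take_size.
rewrite (eq_big_nat _ _ (F2 := fun k => K (take k s))); last first.
  by move=> k /andP[_ lt_k]; rewrite take_rcons_le // ltnW.
rewrite exprD mulrAC; set g := _ * M [::]; move: IH; rewrite -/g => IH.
have [k1 k2] := hK s; have [m1 m2] := hM s.
have pos : 0 < 2 ^+ K s :> R by rewrite exprn_gt0.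
suff : 2 ^- K s * M (rcons s b) <= M s.
  by rewrite mulrC ler_pdivrMr // => h; apply: le_trans h _; rewrite ler_pM2r.
have p1 : 0 < 2 ^- K s :> R by rewrite invr_gt0.
have := M0 (rcons s true); have := M0 (rcons s false).
have /andP[lo0 lo1] := flo01 s; have /andP[hi0 hi1] := fhi01 s.
by move: m1 m2; rewrite /mean => m1 m2 M0f M0t; case: b; nra.
Qed.

(** Upper expectation of [D] at depth [r] below [s], by backward recursion; the maximum over the two
    endpoints is the one-step upper expectation. *)
Fixpoint iter_mean (D : seq bool -> R) r s : R :=
  if r is r'.+1 then
    Num.max (mean (flo phi s) (iter_mean D r') s) (mean (fhi phi s) (iter_mean D r') s)
  else D s.

Section IterMean.
Variable D : seq bool -> R.
Hypothesis D_mono : forall s b, D s <= D (rcons s b).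
Local Notation E := (iter_mean D).

Lemma iter_mean_lo r s : mean (flo phi s) (E r) s <= E r.+1 s.
Proof. by rewrite /= le_max lexx. Qed.

Lemma iter_mean_hi r s : mean (fhi phi s) (E r) s <= E r.+1 s.
Proof. by rewrite /= le_max lexx orbT. Qed.

Lemma iter_meanS_le r s : E r s <= E r.+1 s.
Proof.
elim: r s => [|r IH] s.
  apply: le_trans (iter_mean_lo 0 s); rewrite /mean /=.
  by have := D_mono s true; have := D_mono s false; have /andP[] := flo01 s; nra.
rewrite [leLHS]/= ge_max; apply/andP; split.
  by apply: le_trans (iter_mean_lo _ _); apply: mean_le (flo01 s) _.
by apply: le_trans (iter_mean_hi _ _); apply: mean_le (fhi01 s) _.
Qed.

Lemma iter_mean_mono r r' s : (r <= r')%N -> E r s <= E r' s.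
Proof.
move=> /subnKC <-; elim: (r' - r)%N => [|k IH]; first by rewrite addn0.
by rewrite addnS; apply: le_trans IH (iter_meanS_le _ _).
Qed.

Lemma iter_mean_le M r s : supermartingale phi M ->
  (forall t, size t = (size s + r)%N -> take (size s) t = s -> D t <= M t) ->
  E r s <= M s.
Proof.
move=> hM; elim: r s => [|r IH] s hD; first by apply: hD; rewrite ?addn0 ?take_size.
have [m1 m2] := (supermartingaleP phi M).1 hM s.
have le_rcons b : E r (rcons s b) <= M (rcons s b).
  apply: IH => t; rewrite size_rcons => st tt; apply: hD; first by rewrite st addnS.
  have := congr1 (take (size s)) tt.
  by rewrite take_rcons_le // take_size take_takel.
rewrite /= ge_max; apply/andP; split.
  by apply: le_trans m1; apply: mean_le (flo01 s) _.
by apply: le_trans m2; apply: mean_le (fhi01 s) _.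
Qed.

(** Subadditivity of the upper expectation: what the last [r'] steps add to [D] is charged to
    [M]. *)
Lemma iter_mean_tail M r r' s : supermartingale phi M ->
  (forall t, size t = (size s + r + r')%N ->
    D t <= D (take (size s + r)%N t) + M t) ->
  E (r + r')%N s <= E r s + M s.
Proof.
move=> hM; elim: r s => [|r IH] s hD.
  apply: (iter_mean_le (M := fun t => D s + M t)).
    by apply: supermartingaleD => //; exact: supermartingale_cst.
  by move=> t st tt; have := hD t; rewrite addn0 tt; apply.
have le_rcons b : E (r + r')%N (rcons s b) <= E r (rcons s b) + M (rcons s b).
  by apply: IH => t; rewrite size_rcons !addSnnS; apply: hD.
have [m1 m2] := (supermartingaleP phi M).1 hM s.
have := iter_mean_lo r s; have := iter_mean_hi r s.
have := mean_le (N := fun t => E r t + M t) (flo01 s) le_rcons.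
have := mean_le (N := fun t => E r t + M t) (fhi01 s) le_rcons.
move: m1 m2; rewrite addSn [E (r + r').+1 s]/= ge_max /mean => *.
by apply/andP; split; lra.
Qed.

End IterMean.
End Process.

(** * Supermartingales that dominate the late rewards *)

Section Domination.
Local Open Scope ring_scope.
Variables (R : realType) (phi : fsys R).
Variables (A : nat -> seq bool -> bool) (e : nat -> nat -> nat).
Hypothesis A_small : forall n, (upper_prob phi (cylU (An A n)) <= (2 ^- n : R)%:E)%E.
Hypothesis A_tail : forall N n l, (e N n <= l)%N ->
  (upper_prob phi (cylU (An A n) `\` cylU (An_lt A n l))%classic
     <= (2 ^- N : R)%:E)%E.

Lemma exp2V_lt a b : (b < a)%N -> 2 ^- a < 2 ^- b :> R.
Proof. by move=> ba; rewrite ltf_pV2 ?posrE ?exprn_gt0 // ltr_eXn2l // ltr1n. Qed.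

Lemma exp2V_le a b : (b <= a)%N -> 2 ^- a <= 2 ^- b :> R.
Proof. by move=> ba; rewrite lef_pV2 ?posrE ?exprn_gt0 // ler_eXn2l // ltr1n. Qed.

(** The count is at most 1, so a witness for the upper probability of a late first hit dominates it.
    For n <= 2j the tail bound makes this probability small; for n > 2j the whole set A_(2n+3) is
    already small enough, as 2n + 3 > n + 2j + 2. *)
Lemma hits_supermartingale n j : exists M, [/\ supermartingale phi M,
  M [::] <= 2 ^- (n + 2 * j + 2), (forall s, 0 <= M s) &
  forall s, (hits A e n j s)%:R <= M s].
Proof.
have key (G : set (nat -> bool)) :
    (upper_prob phi G < (2 ^- (n + 2 * j + 2) : R)%:E)%E ->
    (forall s k, (k <= size s)%N -> newhit A n (take k s) ->
       (tail_len e j <= k)%N -> cyl s `<=` G)%classic ->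
    exists M, [/\ supermartingale phi M,
      M [::] <= 2 ^- (n + 2 * j + 2), (forall s, 0 <= M s) &
      forall s, (hits A e n j s)%:R <= M s].
  move=> /upper_prob_witness[M [hM M1 M0 MG]] hG; exists M; split=> // [|s].
    exact: ltW.
  have [|gt0] := leqP (hits A e n j s) 0; first by rewrite leqn0 => /eqP ->.
  have [k [le_k nk hk]] := hits_gt0 gt0.
  apply: le_trans (MG s (hG _ _ le_k nk hk)); rewrite lern1.
  by apply: leq_trans (hits_le_hit _ _ _ _ _) _; case: hit.
have in_cyl s k w : (k <= size s)%N -> newhit A n (take k s) -> cyl s w ->
    cylU (An A (2 * n + 3)) w.
  move=> le_k /andP[/hitP[_ [i]]]; rewrite size_takel // => le_i.
  rewrite take_takel // => Ai _ sw; exists (take i s); split=> //.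
  have le_is := leq_trans le_i le_k.
  by rewrite /cyl /= size_takel // (cyl_take sw).
have [le_nj|lt_jn] := leqP n (2 * j).
  apply: (key (cylU (An A (2 * n + 3)) `\`
               cylU (An_lt A (2 * n + 3) (tail_len e j)))%classic).
    apply: le_lt_trans (A_tail (tail_len_ge e le_nj)) _.
    by rewrite lte_fin exp2V_lt //; lia.
  move=> s k le_k nk hk w sw; split; first exact: in_cyl nk sw.
  (* A member [t] shorter than h(j) <= k on the path would have been seen at length k - 1 already,
     and n <= 2j < k meets the length condition there too. So the hit at [k] would not be new. *)
  move=> [t [/andP[At lt_t] tw]]; move/andP: nk => [_ /negP]; apply.
  have gt_j := tail_len_gt e j.
  rewrite size_takel // take_takel ?leq_pred //.
  apply/hitP; rewrite size_takel; last by lia.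
  split; first lia.
  exists (size t); first lia.
  rewrite take_takel; last by lia.
  by rewrite -(cyl_take sw) ?tw //; lia.
apply: (key (cylU (An A (2 * n + 3)))) => [|s k le_k nk _ w sw]; last exact: in_cyl nk sw.
by apply: le_lt_trans (A_small _) _; rewrite lte_fin exp2V_lt //; lia.
Qed.

Lemma geometric_half_le L : \sum_(0 <= n < L) 2 ^- n.+1 <= 1 :> R.
Proof.
suff -> : \sum_(0 <= n < L) 2 ^- n.+1 = 1 - 2 ^- L :> R.
  by rewrite gerBl invr_ge0 exprn_ge0.
elim: L => [|L IH]; first by rewrite big_geq // expr0 invr1 subrr.
rewrite big_nat_recr //= IH exprS invfM.
by move: (2 ^- L) => x; lra.
Qed.

(** The horizon [L] keeps the sum over levels and indices finite; [M] may depend on it, while the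
    bound at the root does not. *)
Lemma tail_supermartingale i L : exists M, [/\ supermartingale phi M,
  M [::] <= 2 ^- i, (forall s, 0 <= M s) &
  forall s, (size s <= L)%N -> (tail_reward A e i s)%:R <= M s].
Proof.
have [m hm] := choice (fun nj => hits_supermartingale nj.1 nj.2).
pose M s := \sum_(0 <= n < L.+1) \sum_(0 <= j < L) m (n, maxn i j) s.
exists M; split.
- apply: supermartingale_sum => n; apply: supermartingale_sum => j.
  by have [] := hm (n, maxn i j).
(* The exponent n + 2 max(i,j) + 2 is at least i + (n+1) + (j+1), which leaves two geometric series
   with sum at most 1. *)
- have le_m n j : m (n, maxn i j) [::] <= 2 ^- i * (2 ^- n.+1 * 2 ^- j.+1).
    have [_ + _ _] := hm (n, maxn i j); move=> /le_trans; apply.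
    by rewrite -!invfM -!exprD exp2V_le //=; lia.
  have i0 : 0 <= 2 ^- i :> R by rewrite invr_ge0 exprn_ge0.
  apply: le_trans (_ : 2 ^- i * ((\sum_(0 <= n < L.+1) 2 ^- n.+1) *
      (\sum_(0 <= j < L) 2 ^- j.+1)) <= _).
    rewrite mulr_suml mulr_sumr; apply: ler_sum => n _.
    by rewrite mulr_sumr mulr_sumr; apply: ler_sum => j _.
  rewrite -[leRHS]mulr1 ler_wpM2l //.
  apply: mulr_ile1; rewrite ?geometric_half_le //;
    by apply: sumr_ge0 => k _; rewrite invr_ge0 exprn_ge0.
- move=> s; apply: sumr_ge0 => n _; apply: sumr_ge0 => j _.
  by have [_ _] := hm (n, maxn i j).
- move=> s le_s.
  apply: le_trans (_ : (\sum_(0 <= n < L.+1) \sum_(0 <= j < L)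
      hits A e n (maxn i j) s)%N%:R <= _); first by rewrite ler_nat tail_reward_le.
  rewrite natr_sum; apply: ler_sum => n _; rewrite natr_sum; apply: ler_sum => j _.
  by have [_ _ _] := hm (n, maxn i j).
Qed.

End Domination.

(** * Backward recursion in fixed-point arithmetic, with error bounds *)

Section Rounding.
Local Open Scope ring_scope.
Variables (R : realType) (phi : fsys R).

Lemma exp2V_small (x : R) : 0 < x -> exists i, 2 ^- i <= x.
Proof.
move=> x0; exists (Num.bound x^-1).
rewrite -[leRHS]invrK lef_pV2 ?posrE ?exprn_gt0 ?invr_gt0 //.
apply: le_trans (ltW (archi_boundP _)) _; first by rewrite invr_ge0 ltW.
by rewrite -natrX ler_nat ltnW // ltn_expl.
Qed.

(** Capping at 2^P keeps the approximate probabilities in [0,1], so that rounded means remain convex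
    combinations; as r <= 1, the cap only improves the approximation. *)
Lemma unit_nat_approx (r : seq bool -> R) :
  computable_S_R r -> (forall s, 0 <= r s <= 1) ->
  exists x : nat -> nat -> nat, [/\ rc2 x, forall P c, (x P c <= 2 ^ P)%N &
    forall P s, `|r s - (x P (cs s))%:R / 2 ^+ P| <= 2 * 2 ^- P].
Proof.
move=> cr r01; have [|x hx xr] := computable_nat_approx cr.
  by move=> s; have /andP[] := r01 s.
pose y P c := (if x P c <= 2 ^ P then x P c else 2 ^ P)%N.
exists y; split=> [|P c|P s]; first by rewrite /rc2 /y; rct.
  by rewrite /y; case: (leqP (x P c)) => //; rewrite leqnn.
rewrite /y; case: leqP => // lt_x; rewrite natrX divff ?expf_neq0 //.
have /andP[r0 r1] := r01 s.
have : 1 <= (x P (cs s))%:R / 2 ^+ P :> R.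
  by rewrite ler_pdivlMr ?exprn_gt0 // mul1r -natrX ler_nat ltnW.
by have := xr P s; rewrite !ler_norml => /andP[? ?] ?; apply/andP; split; lra.
Qed.

Definition rounded_mean P a y0 y1 : nat := ((a * y1 + (2 ^ P - a) * y0) %/ 2 ^ P)%N.

Fixpoint rounded_iter (al ah : nat -> nat -> nat) (D : seq bool -> nat) P r s : nat :=
  if r is r'.+1 then
    let V b := rounded_iter al ah D P r' (rcons s b) in
    maxn (rounded_mean P (al P (cs s)) (V false) (V true))
         (rounded_mean P (ah P (cs s)) (V false) (V true))
  else D s * 2 ^ P.

(** Three errors add up: 2^-P from rounding down, [eps] from the children (kept by a convex
    combination), and 2 B 2^-P from the error in [p], since the two values differ by at most [B]. *)
Lemma rounded_mean_error (P a y0 y1 B : nat) (p x0 x1 eps : R) :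
  (a <= 2 ^ P)%N -> `|p - a%:R / 2 ^+ P| <= 2 * 2 ^- P ->
  0 <= x0 <= B%:R -> 0 <= x1 <= B%:R ->
  `|y0%:R / 2 ^+ P - x0| <= eps -> `|y1%:R / 2 ^+ P - x1| <= eps ->
  `|(rounded_mean P a y0 y1)%:R / 2 ^+ P - (p * x1 + (1 - p) * x0)|
     <= eps + (2 * B + 1)%:R * 2 ^- P.
Proof.
move=> aP; set d := 2 ^- P; set al := a%:R / 2 ^+ P.
have P0 : 0 < 2 ^+ P :> R by rewrite exprn_gt0.
have d0 : 0 < d by rewrite invr_gt0.
have al0 : 0 <= al by rewrite divr_ge0 // ltW.
have al1 : al <= 1 by rewrite ler_pdivrMr // mul1r -natrX ler_nat.
set Y0 := y0%:R / _; set Y1 := y1%:R / _ => hp hx0 hx1 h0 h1.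
set u := (a * y1 + (2 ^ P - a) * y0)%N.
have uE : u%:R / 2 ^+ P / 2 ^+ P = al * Y1 + (1 - al) * Y0.
  rewrite /u natrD !natrM natrB // natrX /al /Y1 /Y0.
  by field; rewrite expf_neq0.
set z := rounded_mean P a y0 y1.
have z1 : z%:R <= u%:R / 2 ^+ P :> R.
  by rewrite ler_pdivlMr // -natrX -natrM ler_nat leq_trunc_div.
have z2 : u%:R / 2 ^+ P <= z%:R + 1 :> R.
  rewrite ler_pdivrMr // -natrX natr1 -natrM ler_nat ltnW //.
  by rewrite ltn_ceil // expn_gt0.
have zu : `|z%:R / 2 ^+ P - (al * Y1 + (1 - al) * Y0)| <= d.
  rewrite -uE -mulrBl normrM (gtr0_norm d0); apply: ler_piMl; first exact: ltW.
  by rewrite ler_norml; apply/andP; split; lra.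
have conv : `|al * (Y1 - x1) + (1 - al) * (Y0 - x0)| <= eps.
  move: h0 h1; rewrite !ler_norml => /andP[? ?] /andP[? ?].
  by apply/andP; split; nra.
have dev : `|(al - p) * (x1 - x0)| <= 2 * B%:R * d.
  rewrite normrM distrC mulrAC; apply: ler_pM => //.
  by move: hx0 hx1; rewrite ler_norml => /andP[? ?] /andP[? ?]; apply/andP; split; lra.
have -> : z%:R / 2 ^+ P - (p * x1 + (1 - p) * x0) =
    (z%:R / 2 ^+ P - (al * Y1 + (1 - al) * Y0)) +
    (al * (Y1 - x1) + (1 - al) * (Y0 - x0)) + (al - p) * (x1 - x0) by ring.
rewrite natrD natrM [X in _ <= eps + X]mulrDl mul1r.
apply: le_trans (ler_normD _ _) _; apply: le_trans (lerD (ler_normD _ _) dev) _.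
by rewrite (addrC (2%:R * B%:R * d)) addrA lerD2r addrC lerD.
Qed.

Section RoundedIter.
Variables (al ah : nat -> nat -> nat) (D : seq bool -> nat).
Hypothesis al_le : forall P c, (al P c <= 2 ^ P)%N.
Hypothesis ah_le : forall P c, (ah P c <= 2 ^ P)%N.
Hypothesis al_approx : forall P s, `|flo phi s - (al P (cs s))%:R / 2 ^+ P| <= 2 * 2 ^- P.
Hypothesis ah_approx : forall P s, `|fhi phi s - (ah P (cs s))%:R / 2 ^+ P| <= 2 * 2 ^- P.
Hypothesis D_mono : forall s b, (D s <= D (rcons s b))%N.
Local Notation E := (iter_mean phi (fun s => (D s)%:R)).
Local Notation V := (rounded_iter al ah D).

(** The maximum does not enlarge errors, so each of the [r] levels adds the error of one rounded
    mean. *)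
Lemma rounded_iter_error (P B r : nat) s :
  (forall t, (size t <= size s + r)%N -> (D t <= B)%N) ->
  `|(V P r s)%:R / 2 ^+ P - E r s| <= r%:R * ((2 * B + 1)%:R * 2 ^- P).
Proof.
have DR t b : (D t)%:R <= (D (rcons t b))%:R :> R by rewrite ler_nat.
elim: r s => [|r IH] s hB.
  by rewrite /= natrM natrX mulfK ?expf_neq0 // subrr normr0 mul0r.
have hBr b t : (size t <= size (rcons s b) + r)%N -> (D t <= B)%N.
  by rewrite size_rcons addSnnS; exact: hB.
have E_bd b : 0 <= E r (rcons s b) <= B%:R.
  apply/andP; split.
    by apply: le_trans (iter_mean_mono phi DR (rcons s b) (leq0n r)); rewrite /= ler0n.
  apply: (iter_mean_le (supermartingale_cst phi B%:R)) => t st _.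
  by rewrite ler_nat (hBr b) // st.
have err p a : (a <= 2 ^ P)%N -> `|p - a%:R / 2 ^+ P| <= 2 * 2 ^- P ->
    `|(rounded_mean P a (V P r (rcons s false)) (V P r (rcons s true)))%:R / 2 ^+ P
      - mean p (E r) s| <= r.+1%:R * ((2 * B + 1)%:R * 2 ^- P).
  move=> aP pa; rewrite -[r.+1%:R]natr1 [leRHS]mulrDl mul1r.
  by apply: rounded_mean_error => //; apply: IH; exact: hBr.
have := err _ _ (al_le P (cs s)) (al_approx P s).
have := err _ _ (ah_le P (cs s)) (ah_approx P s).
rewrite /=; move: (r.+1%:R * _) => d.
set a := rounded_mean _ _ _ _; set b := rounded_mean _ _ _ _.
have -> : (maxn b a)%:R / 2 ^+ P = Num.max (b%:R / 2 ^+ P) (a%:R / 2 ^+ P) :> R.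
  rewrite -maxr_pMl ?invr_ge0 ?exprn_ge0 //; congr (_ * _).
  by case: (leqP a b) => ab; [rewrite max_l | rewrite max_r]; rewrite // ler_nat // ltnW.
rewrite !ler_norml => /andP[h1 h2] /andP[h3 h4].
by case: (leP (b%:R / _)); case: (leP (mean (flo phi s) _ _)) => ? ?;
  apply/andP; split; lra.
Qed.

End RoundedIter.
End Rounding.

Lemma rc3_rounded_iter al ah (D : seq bool -> nat) :
  rc2 al -> rc2 ah -> rc1 (fun c => D (str c)) ->
  rc3 (fun L P c => rounded_iter al ah D P (L - size (str c)) (str c)).
Proof.
move=> hal hah hD.
have hmean : rc4 rounded_mean by rewrite /rc4 /rounded_mean; rct.
have hmax : rc2 maxn.
  apply: (rc_ext (f := fun x => if x.1 <= x.2.1 then x.2.1 else x.1)); last by rct.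
  by move=> x; case: leqP.
apply: (@rc3_tree (fun c P => D (str c) * 2 ^ P)
  (fun c y0 y1 P => maxn (rounded_mean P (al P c) y0 y1) (rounded_mean P (ah P c) y0 y1))
  (* The heap numbers below 2^L - 1 are exactly the strings shorter than [L]; at other strings the
     truncated difference is 0. *)
  (fun L => (2 ^ L).-1)).
- by rewrite /rc2; rct; apply: (rc_app1 hD); rct.
- by rewrite /rc4; rct.
- by rewrite /rc1; rct.
- move=> L P c le_c; have := cs_size (str c); rewrite strK => /andP[_ lt_c].
  have le_L : L <= size (str c) by rewrite -ltnS -(@ltn_exp2l 2) //; lia.
  by have /eqP -> : L - size (str c) == 0 by rewrite subn_eq0.
- move=> L P c lt_c; have := cs_size (str c); rewrite strK => /andP[le_c _].
  have lt_L : size (str c) < L by rewrite -(@ltn_exp2l 2) //; lia.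
  have child (b : bool) : str (c.*2 + 1 + b) = rcons (str c) b.
    by rewrite -{1}(strK c) -cs_rcons csK.
  have c0 : str c.*2.+1 = rcons (str c) false by rewrite -child; congr str; lia.
  have c1 : str c.*2.+2 = rcons (str c) true by rewrite -child; congr str; lia.
  by rewrite c0 c1 !size_rcons -(subnSK lt_L) /= strK.
Qed.

(** * The rewards are recursive *)

Section RewardRecursive.
Variables (A : nat -> seq bool -> bool) (e : nat -> nat -> nat).
Hypotheses (hA : rc2 (fun n c => A n (str c))) (he : rc2 e).

Lemma rc1_tail_len : rc1 (tail_len e).
Proof. by rewrite /rc1 /tail_len; rct. Qed.

Lemma rc1_growth : rc1 (growth e).
Proof. by have ? := rc1_tail_len; rewrite /rc1 /growth; rct. Qed.

Lemma rc2_hit : rc2 (fun n c => hit A n (str c)).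
Proof.
apply: (rc_ext (f := fun x => (x.1 <= size (str x.2.1)) &&
  has (fun i => A (2 * x.1 + 3) (str (cs (take i (str x.2.1)))))
    (iota 0 (size (str x.2.1)).+1))).
  by move=> x; congr (nat_of_bool (_ && _)); apply: eq_has => i; rewrite csK.
by rct; apply: (rc_app2 hA); rct.
Qed.

Lemma rc2_newhit : rc2 (fun n c => newhit A n (str c)).
Proof.
apply: (rc_ext (f := fun x => hit A x.1 (str x.2.1) &&
  ~~ hit A x.1 (str (cs (take (size (str x.2.1)).-1 (str x.2.1)))))).
  by move=> x; rewrite /newhit csK.
by rct; apply: (rc_app2 rc2_hit); rct.
Qed.

Lemma rc1_reward : rc1 (fun c => reward A e (str c)).
Proof.
have ? := rc1_growth; rewrite /rc1 /reward; rct.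
by apply: (rc_app2 rc2_newhit); rct.
Qed.

Lemma rc1_total : rc1 (fun c => total_reward A e (str c)).
Proof.
apply: (rc_ext (f := fun x => \sum_(0 <= k < (size (str x.1)).+1)
   reward A e (str (cs (take k (str x.1)))))).
  by move=> x; apply: eq_bigr => k _; rewrite csK.
by rct; apply: (rc_app1 rc1_reward); rct.
Qed.

End RewardRecursive.

(** * Schnorr randomness implies Schnorr test randomness *)

Section Converse.
Local Open Scope ring_scope.
Variables (R : realType) (phi : fsys R) (w : nat -> bool).

Section Construction.
Variables (A : nat -> seq bool -> bool) (e : nat -> nat -> nat) (K : seq bool -> nat).
Hypothesis A_small : forall n, (upper_prob phi (cylU (An A n)) <= (2 ^- n : R)%:E)%E.
Hypothesis A_tail : forall N n l, (e N n <= l)%N ->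
  (upper_prob phi (cylU (An A n) `\` cylU (An_lt A n l))%classic
     <= (2 ^- N : R)%:E)%E.
Hypothesis K_le : forall s, 2 ^- K s <= fhi phi s /\ 2 ^- K s <= 1 - flo phi s.

Definition kappa s := (\sum_(0 <= k < size s) K (take k s))%N.

Local Notation E := (iter_mean phi (fun s => (total_reward A e s)%:R)).

Definition limit_mean s : R := sup (range (fun r => E r s)).
Local Notation T := limit_mean.

Lemma total_reward_mono s b :
  (total_reward A e s)%:R <= (total_reward A e (rcons s b))%:R :> R.
Proof. by rewrite ler_nat total_reward_rcons leq_addr. Qed.

Lemma iter_mean_reward_le r s : E r s <= 2 ^+ kappa s.
Proof.
have [M [hM M1 M0 MD]] := tail_supermartingale A_small A_tail 0 (size s + r).
apply: le_trans (_ : M s <= _).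
  apply: iter_mean_le => // t st _; apply: le_trans (MD t _); last by rewrite st.
  by rewrite ler_nat total_reward_le_tail.
apply: le_trans (supermartingale_growth K_le hM M0 s) _.
by rewrite -/(kappa s) ler_piMr ?exprn_ge0 // (le_trans M1) // expr0 invr1.
Qed.

Lemma iter_mean_reward_tail i r r' s : (tail_len e i <= size s + r)%N ->
  E (r + r')%N s <= E r s + 2 ^+ kappa s * 2 ^- i.
Proof.
move=> le_i.
have [M [hM M1 M0 MD]] := tail_supermartingale A_small A_tail i (size s + r + r').
apply: le_trans (_ : E r s + M s <= _); last first.
  rewrite lerD2l; apply: le_trans (supermartingale_growth K_le hM M0 s) _.
  by rewrite ler_wpM2l ?exprn_ge0.
apply: iter_mean_tail => // t st.
have le_M := MD t; rewrite st leqnn in le_M; have {}le_M := le_M isT.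
apply: le_trans (lerD (lexx _) le_M).
by rewrite -natrD ler_nat total_reward_split // st leq_addr.
Qed.

Lemma iter_mean_le_limit r s : E r s <= T s.
Proof.
have ub : has_ubound (range (fun r => E r s)).
  by exists (2 ^+ kappa s) => _ [k _ <-]; exact: iter_mean_reward_le.
by apply: (ub_le_sup ub); exists r.
Qed.

(** An explicit rate of convergence in the horizon; both the supermartingale property of [T] and its
    computability rest on it. *)
Lemma limit_mean_le i r s : (tail_len e i <= size s + r)%N ->
  T s <= E r s + 2 ^+ kappa s * 2 ^- i.
Proof.
move=> le_i; apply: ge_sup; first by exists (E 0%N s); exists 0%N.
move=> _ [r' _ <-]; have [le_r|lt_r] := leqP r r'.
  by rewrite -(subnKC le_r); exact: iter_mean_reward_tail.
rewrite (le_trans (iter_mean_mono phi total_reward_mono s (ltnW lt_r))) //.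
by rewrite lerDl mulr_ge0 ?invr_ge0 ?exprn_ge0.
Qed.

Lemma limit_mean_root : T [::] <= 1.
Proof.
apply: ge_sup; first by exists (E 0%N [::]); exists 0%N.
move=> _ [r _ <-]; apply: le_trans (iter_mean_reward_le _ _) _.
by rewrite /kappa big_geq.
Qed.

Lemma limit_mean_supermartingale : supermartingale phi T.
Proof.
suff hp p s : 0 <= p <= 1 -> (forall r, mean p (E r) s <= E r.+1 s) -> mean p T s <= T s.
  apply/supermartingaleP => s; split; apply: hp => [|r].
  - exact: flo01.
  - exact: iter_mean_lo.
  - exact: fhi01.
  - exact: iter_mean_hi.
move=> p01 hE; apply/ler_addgt0Pr => eps eps0.
(* The two children share one horizon; [i] is chosen so that their convergence errors together stay
   below [eps]. *)
pose C : R := 2 ^+ kappa (rcons s true) + 2 ^+ kappa (rcons s false).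
have C1 : 0 < 2 ^+ kappa (rcons s true) :> R by rewrite exprn_gt0.
have C2 : 0 < 2 ^+ kappa (rcons s false) :> R by rewrite exprn_gt0.
have C0 : 0 < C by rewrite addr_gt0.
have [i] := exp2V_small (divr_gt0 eps0 C0); rewrite ler_pdivlMr // => hi.
have i0 : 0 < 2 ^- i :> R by rewrite invr_gt0 exprn_gt0.
have le_r b : (tail_len e i <= size (rcons s b) + tail_len e i)%N by rewrite leq_addl.
have := limit_mean_le (le_r true); have := limit_mean_le (le_r false).
have := iter_mean_le_limit (tail_len e i).+1 s; have := hE (tail_len e i).
case/andP: p01 => p0 p1; move: hi; rewrite /C /mean mulrDr ![_ * 2 ^- i]mulrC.
have := mulr_gt0 i0 C1; have := mulr_gt0 i0 C2.
move: (2 ^- i * 2 ^+ _) (2 ^- i * 2 ^+ _) => u v u0 v0 hi h1 h2 h3 h4.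
have := ler_wpM2l p0 h4; have p1' : 0 <= 1 - p by lra.
have := ler_wpM2l p1' h3; have := ler_wpM2l p0 (ltW u0); have := ler_wpM2l p1' (ltW v0).
by lra.
Qed.

Lemma limit_mean_ge_total s : (total_reward A e s)%:R <= T s.
Proof. exact: (iter_mean_le_limit 0). Qed.

(* [T] has value at most 1 at the root, and lifting it to exactly 1 there is harmless. *)
Definition test_process s : R := if s is [::] then 1 else T s.

Lemma test_process_rcons s b : test_process (rcons s b) = T (rcons s b).
Proof. by case: s. Qed.

Lemma test_process_supermartingale : test_supermartingale phi test_process.
Proof.
have /supermartingaleP hT := limit_mean_supermartingale.
split; [|split] => // [|s].
  apply/supermartingaleP => s; rewrite /mean !test_process_rcons.
  have [h1 h2] := hT s.
  suff : T s <= test_process s by move=> h; split; apply: le_trans h.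
  by case: s {h1 h2} => //=; exact: limit_mean_root.
by case: s => //= b s; apply: le_trans (limit_mean_ge_total _).
Qed.

Lemma test_process_unbounded : (forall n, cylU (An A n) w) ->
  forall N, exists2 m, (N <= m)%N &
    (1 : R) <= test_process (Defs.prefix w m) - (growth e m).-1%:R.
Proof.
(* A level can be hit only at lengths at least [n], so its first hit along [w] comes after both [N]
   and h(1). The latter gives growth at least 1, and the predecessor in the growth function then
   leaves a margin of 1. *)
move=> hw N; pose n := (N + tail_len e 1).+1.
have ex_hit : exists m, hit A n (Defs.prefix w m).
  have [s [As sw]] := hw (2 * n + 3)%N; exists (n + size s)%N.
  apply/hitP; rewrite size_path_prefix; split; first by rewrite leq_addr.
  by exists (size s); rewrite ?leq_addl // take_path_prefix ?leq_addl // sw.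
case: (ex_minnP ex_hit) => m hm min_m.
have le_nm : (n <= m)%N by have /andP[] := hm; rewrite size_path_prefix.
have new_m : newhit A n (Defs.prefix w m).
  rewrite /newhit hm size_path_prefix take_path_prefix ?leq_pred //=.
  by apply/negP => /min_m; rewrite /n in le_nm *; lia.
have g1 : (1 <= growth e m)%N by apply: growth_ge; rewrite /n in le_nm; lia.
have le_g : (growth e m <= total_reward A e (Defs.prefix w m))%N.
  rewrite /total_reward size_path_prefix big_nat_recr //=.
  rewrite take_oversize ?size_path_prefix //.
  rewrite (leq_trans _ (leq_addl _ _)) // /reward size_path_prefix leq_pmulr //.
  rewrite (@big_cat_nat _ _ _ n) //=; last by lia.
  by rewrite (@big_ltn _ _ _ n) //= new_m addnCA.
exists m; first by rewrite /n in le_nm; lia.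
have -> : test_process (Defs.prefix w m) = T (Defs.prefix w m).
  by case: m le_nm {hm min_m new_m g1 le_g}.
have := limit_mean_ge_total (Defs.prefix w m).
have : (growth e m)%:R <= (total_reward A e (Defs.prefix w m))%:R :> R by rewrite ler_nat.
by rewrite -(prednK g1) -natr1 /=; lra.
Qed.

Lemma test_process_computable (al ah : nat -> nat -> nat) :
  rc2 (fun n c => A n (str c)) -> rc2 e -> rc1 (fun c => K (str c)) ->
  rc2 al -> rc2 ah ->
  (forall P c, (al P c <= 2 ^ P)%N) -> (forall P c, (ah P c <= 2 ^ P)%N) ->
  (forall P s, `|flo phi s - (al P (cs s))%:R / 2 ^+ P| <= 2 * 2 ^- P) ->
  (forall P s, `|fhi phi s - (ah P (cs s))%:R / 2 ^+ P| <= 2 * 2 ^- P) ->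
  computable_S_R test_process.
Proof.
move=> hA he hK hal hah al_le ah_le al_approx ah_approx.
(* This horizon leaves the error 2^kappa 2^-(N+1+kappa) = 2^-(N+1). *)
pose depth N c := tail_len e (N.+1 + kappa (str c)).
pose bound N c := (2 * (size (str c) + depth N c).+1 ^ 3 + 1)%N.
(* Rounding errors total at most depth * bound * 2^-P, and making the numerator odd adds half a
   unit; x + 1 <= 2^(x+1) keeps the sum within 2^-(N+1). *)
pose P N c := (N.+1 + (depth N c * bound N c).+1)%N.
(* Code 0 is the root, where the process was set to 1. *)
pose V N c := (if c == 0 then 2 ^ P N c else
  rounded_iter al ah (total_reward A e) (P N c)
    ((size (str c) + depth N c) - size (str c)) (str c))%N.
have rc_kappa : rc1 (fun c => kappa (str c)).
  apply: (rc_ext (f := fun x => \sum_(0 <= k < size (str x.1))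
     K (str (cs (take k (str x.1)))))%N).
    by move=> x; apply: eq_bigr => k _; rewrite csK.
  by rct; apply: (rc_app1 hK); rct.
have rc_len := rc1_tail_len he.
have rc_depth : rc2 depth by rewrite /rc2 /depth; rct; apply: (rc_app1 rc_kappa); rct.
have rc_bound : rc2 bound by rewrite /rc2 /bound; rct.
have rc_P : rc2 P by rewrite /rc2 /P; rct.
have rc_V : rc2 V.
  rewrite /rc2 /V; rct.
  by apply: (rc_app3 (rc3_rounded_iter hal hah (rc1_total hA he))); rct.
apply: (computable_of_nat rc_V rc_P) => N s.
have exp0 k : 0 < 2 ^+ k :> R by rewrite exprn_gt0.
have p0 : 0 < 2 ^- P N (cs s) :> R by rewrite invr_gt0.
have roundE v p : v.*2.+1%:R / (2 ^ p.+1)%:R = v%:R / 2 ^+ p + 2 ^- p / 2 :> R.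
  rewrite -muln2 -natr1 natrM natrX exprS.
  by field; rewrite expf_neq0.
rewrite roundE; case: s p0 => [|b s] p0.
  rewrite /V /= natrX divff ?expf_neq0 // opprD addrA subrr sub0r normrN.
  have le_N : 2 ^- P N (cs [::]) <= 2 ^- N :> R by rewrite exp2V_le // /P; lia.
  by move: p0 le_N; move: (2 ^- P _ _) => q q0 le_N; rewrite ger0_norm; lra.
set t := b :: s; rewrite -/t in p0 *.
have cs_t : cs t != 0%N.
  by apply/eqP => h; have := csK t; rewrite h.
rewrite /V (negbTE cs_t) csK addKn [test_process t]/=.
set r := depth N (cs t); set p := P N (cs t); rewrite -/p in p0 *.
have le_T := @limit_mean_le (N.+1 + kappa t) r t.
have {}le_T : T t <= E r t + 2 ^- N.+1.
  apply: le_trans (le_T _) _; first by rewrite /r /depth csK leq_addl.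
  by rewrite lerD2l exprD invfM mulrCA divff ?mulr1 // expf_neq0.
have ge_T := iter_mean_le_limit r t.
set v := _%:R / 2 ^+ p; set d : R := r%:R * ((bound N (cs t))%:R * 2 ^- p).
have err : `|v - E r t| <= d.
  rewrite /v /d /bound csK; apply: rounded_iter_error => //.
    by move=> u c; rewrite total_reward_rcons leq_addr.
  by move=> u le_u; apply: leq_trans (total_reward_le _ _ _) _; rewrite leq_exp2r.
have small : d + 2 ^- p <= 2 ^- N.+1 :> R.
  rewrite /d mulrA -natrM -[X in _ + X]mul1r -mulrDl natr1 ler_pdivrMr //.
  rewrite /p /P exprD mulrA mulVf ?mul1r ?expf_neq0 // -natrX ler_nat.
  by rewrite ltnW // ltn_expl.
have hN : 2 ^- N = 2 ^- N.+1 + 2 ^- N.+1 :> R.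
  by rewrite exprS invfM; move: (2 ^- N) => x; lra.
have N0 : 0 < 2 ^- N.+1 :> R by rewrite invr_gt0.
rewrite hN; move: err small p0 N0 le_T ge_T.
move: v d (2 ^- p) (2 ^- N.+1) => v d q x.
rewrite !ler_norml => /andP[? ?] *.
by apply/andP; split; lra.
Qed.

End Construction.

Lemma schnorr_random_test_random :
  non_degenerate phi -> computable_fsys phi ->
  schnorr_random phi w -> schnorr_test_random phi w.
Proof.
move=> nondeg [clo chi] hw A [/recursive_set_NS_rc2 hA [A_small [e [he A_tail]]]] w_A.
move/recursive_NN_N_rc2: he => he.
have [al [hal al_le al_approx]] := unit_nat_approx clo (flo01 phi).
have [ah [hah ah_le ah_approx]] := unit_nat_approx chi (fhi01 phi).
(* A decidable certificate: the approximations err by at most 2 units of 2^-k, so 3 units guarantee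
   a true margin of one unit, and a true margin of 5 units guarantees the 3. Non-degeneracy makes
   the search for [k] end, so the least such [k] is recursive. *)
pose good k c := (3 <= ah k c)%N && (al k c + 3 <= 2 ^ k)%N.
have natE k a : a%:R = a%:R / 2 ^+ k * 2 ^+ k :> R by rewrite divfK // expf_neq0.
have ex_good c : exists k, good k c.
  have [lo1 hi0] := nondeg (str c).
  have m0 : 0 < Num.min (fhi phi (str c)) (1 - flo phi (str c)) / 5%:R.
    by rewrite divr_gt0 // lt_min hi0 subr_gt0.
  have [k] := exp2V_small m0; rewrite ler_pdivlMr // le_min => /andP[k1 k2].
  exists k; have := al_approx k (str c); have := ah_approx k (str c); rewrite strK.
  rewrite !ler_norml => /andP[_ h1] /andP[h2 _].
  have q0 : 0 < 2 ^+ k :> R by rewrite exprn_gt0.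
  apply/andP; split; rewrite -(ler_nat R).
    rewrite (natE k (ah k c)) -ler_pdivrMr //; lra.
  rewrite natrD natrX (natE k (al k c)) -[X in _ <= X]mul1r -lerBrDl.
  rewrite -mulrBl -ler_pdivrMr //.
  lra.
pose K s := ex_minn (ex_good (cs s)).
have rc_K : rc1 (fun c => K (str c)).
  apply: (@rc_mu _ _ (fun k x => good k x.1)); cbv beta.
  - by rewrite /good; rct.
  - by move=> x; rewrite /K; case: ex_minnP => k; rewrite strK.
  - move=> x k; rewrite /K; case: ex_minnP => m _ min_m.
    by apply: contraL => gk; rewrite -leqNgt min_m // strK.
have K_le s : 2 ^- K s <= fhi phi s /\ 2 ^- K s <= 1 - flo phi s.
  rewrite /K; case: ex_minnP => k /andP[g1 g2] _.
  have := al_approx k s; have := ah_approx k s.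
  rewrite !ler_norml => /andP[h1 _] /andP[_ h2].
  have q0 : 0 < 2 ^+ k :> R by rewrite exprn_gt0.
  have {}g1 : 3%:R / 2 ^+ k <= (ah k (cs s))%:R / 2 ^+ k :> R.
    by rewrite ler_pdivrMr // -natE ler_nat.
  have {}g2 : 3%:R / 2 ^+ k <= 1 - (al k (cs s))%:R / 2 ^+ k :> R.
    rewrite ler_pdivrMr // mulrBl mul1r -natE lerBrDl -natrD -natrX.
    by rewrite ler_nat.
  by split; lra.
have := hw (test_process A e) (fun m => (growth e m).-1)
  (test_process_supermartingale A_small A_tail K_le)
  (test_process_computable A_small A_tail K_le hA he rc_K hal hah al_le ah_le
     al_approx ah_approx).
have rc_g := rc1_growth he.
have grow : growth_function (fun m => (growth e m).-1).
  split; first by apply/rc1P; rewrite /rc1; rct.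
  split=> [m n mn|m]; first by have := growth_mono e mn; lia.
  exists (tail_len e m.+1); have := growth_ge (leqnn (tail_len e m.+1)); lia.
move=> /(_ grow); apply/negP; rewrite -ltNge.
apply: (@lt_le_trans _ _ 1%:E); first by rewrite lte_fin ltr01.
apply: limn_esup_ge => N.
have [m le_m hm] := test_process_unbounded A_small A_tail K_le w_A N.
by exists m.
Qed.

End Converse.

Theorem theorem8p5 (R : realType) (phi : fsys R) (w : nat -> bool) :
  non_degenerate phi -> computable_fsys phi ->
  (schnorr_random phi w <-> schnorr_test_random phi w).
Proof.
move=> nondeg comp; split; first exact: schnorr_random_test_random.
exact: schnorr_test_random_random.
Qed.
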